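(* Let $\Bbbk$ be a field of characteristic $0$ and let $\mathbf{h}$ be a connected bimonoid in species over $\Bbbk$. If $\mathbf{h}$ is cocommutative, then $\log(\mathrm{id})$ maps to $\mathcal{P}(\mathbf{h})$ and is in fact a projection from $\mathbf{h}$ onto $\mathcal{P}(\mathbf{h})$. If $\mathbf{h}$ is commutative, then $\log(\mathrm{id})$ factors through $\mathcal{Q}(\mathbf{h})$ and splits the canonical projection $\mathbf{h}\twoheadrightarrow\mathcal{Q}(\mathbf{h})$.
   Context: Species and bimonoids. A species is a functor $\mathbf{p}$ from the category of finite sets and bijections to $\Bbbk$-vector spaces; morphisms are natural transformations. $I=S\sqcup T$ means that $(S,T)$ is an ordered pair of disjoint, possibly empty, subsets with union $I$. The Cauchy product is $(\mathbf{p}\cdot\mathbf{q})[I]=\bigoplus_{I=S\sqcup T}\mathbf{p}[S]\otimes\mathbf{q}[T]$; with the symmetry $x\otimes y\mapsto y\otimes x$ and unit the species that is $\Bbbk$ on $\emptyset$ and $0$ elsewhere, species form a symmetric monoidal category. Monoids, comonoids and bimonoids are taken in this category, with structure maps $\mu_{S,T},\iota_\emptyset$ (product $\mathbf{a}[S]\otimes\mathbf{a}[T]\to\mathbf{a}[I]$, unit) and $\Delta_{S,T},\epsilon_\emptyset$ (coproduct $\mathbf{c}[I]\to\mathbf{c}[S]\otimes\mathbf{c}[T]$, counit); in a bimonoid, product and unit are morphisms of comonoids. Commutative means $\mu_{S,T}(x\otimes y)=\mu_{T,S}(y\otimes x)$; cocommutative is the dual condition. A bimonoid is connected if $\dim\mathbf{h}[\emptyset]=1$.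 A composition $F=(I_1,\dots,I_k)\vDash I$ is a sequence of pairwise disjoint nonempty subsets with union $I$; $\ell(F)=k$. $\mu_F$ and $\Delta_F$ are the iterated product $\mathbf{h}[I_1]\otimes\cdots\otimes\mathbf{h}[I_k]\to\mathbf{h}[I]$ and iterated coproduct in the other direction (identities for $k=1$). The logarithm of $\mathrm{id}$ is taken in the convolution algebra of species endomorphisms of $\mathbf{h}$; explicitly $\log(\mathrm{id})_\emptyset=0$ and, for $I\neq\emptyset$, $$\log(\mathrm{id})_I=\sum_{F\vDash I}\frac{(-1)^{\ell(F)-1}}{\ell(F)}\,\mu_F\Delta_F.$$ $\mathcal{P}(\mathbf{h})$ (primitive part) and $\mathcal{Q}(\mathbf{h})$ (indecomposable quotient) are the species that vanish on $\emptyset$ and are given for $I\neq\emptyset$ by $\mathcal{P}(\mathbf{h})[I]=\bigcap\ker(\Delta_{S,T})$ and $\mathcal{Q}(\mathbf{h})[I]=\mathbf{h}[I]/\sum\mathrm{im}(\mu_{S,T})$, both over all $I=S\sqcup T$ with $S,T\neq\emptyset$. ''Splits the canonical projection'' means that the induced morphism $\mathcal{Q}(\mathbf{h})\to\mathbf{h}$, followed by the canonical projection $\mathbf{h}\to\mathcal{Q}(\mathbf{h})$, is the identity. *)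

(* Defs.v *)
From HB Require Import structures.
From mathcomp Require Import all_boot all_algebra.
From mathcomp Require Import generic_quotient ring_quotient finmap.
From mathcomp Require Import boolp.
From mathcomp Require Import monalg.

Set Implicit Arguments.
Unset Strict Implicit.
Unset Printing Implicit Defensive.

Import GRing.Theory.
Local Open Scope ring_scope.
Local Open Scope quotient_scope.

Section Span.
Variables (k : fieldType) (V : lmodType k).

Inductive span (G : V -> Prop) : V -> Prop :=
| span0 : span G 0
| span_lin a x y : G x -> span G y -> span G (a *: x + y).

Definition span_pred (G : V -> Prop) : {pred V} := fun x => `[< span G x >].

Lemma span_predP G x : reflect (span G x) (x \in span_pred G).
Proof. exact: asboolP. Qed.

Lemma span_gen G x : G x -> span G x.
Proof. by move=> Gx; rewrite -[x]addr0 -[x]scale1r; apply: span_lin => //; exact: span0. Qed.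

Lemma spanD G x y : span G x -> span G y -> span G (x + y).
Proof.
by elim=> [|a u v Gu _ IH] Gy; rewrite ?add0r // -addrA; apply: span_lin => //; exact: IH.
Qed.

Lemma spanZ G c x : span G x -> span G (c *: x).
Proof.
elim=> [|a u v Gu _ IH]; first by rewrite scaler0; exact: span0.
by rewrite scalerDr scalerA; exact: span_lin.
Qed.

Lemma span_submod_closed G : submod_closed (span_pred G).
Proof.
split; first by apply/span_predP; exact: span0.
move=> a x y /span_predP xG /span_predP yG.
by apply/span_predP; apply: spanD => //; exact: spanZ.
Qed.

HB.instance Definition _ G :=
  GRing.isSubmodClosed.Build k V (span_pred G) (span_submod_closed G).

End Span.

Lemma span_map (k : fieldType) (V W : lmodType k) (G : V -> Prop) (H : W -> Prop)
    (f : {linear V -> W}) :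
  (forall x, G x -> span H (f x)) -> forall x, span G x -> span H (f x).
Proof.
move=> GH x; elim=> [|a u v Gu _ IH]; first by rewrite linear0; exact: span0.
by rewrite linearP; apply: spanD => //; apply: spanZ; exact: GH.
Qed.

Section QuotSpan.
Variables (k : fieldType) (V : lmodType k) (G : V -> Prop).

Definition quot_span : Type := Quotient.quot (span_pred G).
HB.instance Definition _ :=
  GRing.Zmodule.copy quot_span (Quotient.quot (span_pred G)).

Definition qproj (x : V) : quot_span := \pi_(Quotient.quot (span_pred G)) x.
Definition qrepr (q : quot_span) : V := repr (q : Quotient.quot (span_pred G)).

Lemma qreprK q : qproj (qrepr q) = q. Proof. exact: reprK. Qed.

Lemma qprojP x y : qproj x = qproj y <-> span G (x - y).
Proof.
split=> [/eqP|xy]; first by rewrite /qproj -Quotient.idealrBE => /span_predP.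
by apply/eqP; rewrite /qproj -Quotient.idealrBE; apply/span_predP.
Qed.

Lemma qproj_rel x : span G x -> qproj x = qproj 0.
Proof. by move=> Gx; apply/qprojP; rewrite subr0. Qed.

Lemma qprojD : {morph qproj : x y / x + y}.
Proof. by move=> x y; rewrite /qproj [LHS]Quotient.pi_add. Qed.

Definition qscale (c : k) (q : quot_span) : quot_span := qproj (c *: qrepr q).

Lemma qprojZ c x : qproj (c *: x) = qscale c (qproj x).
Proof. by apply/qprojP; rewrite -scalerBr; apply/spanZ/qprojP; rewrite qreprK. Qed.

Fact qscaleA a b q : qscale a (qscale b q) = qscale (a * b) q.
Proof. by rewrite -[q]qreprK -!qprojZ scalerA. Qed.
Fact qscale1 : left_id 1 qscale.
Proof. by move=> q; rewrite -[q]qreprK -!qprojZ scale1r. Qed.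
Fact qscaleDr : right_distributive qscale +%R.
Proof.
by move=> c p q; rewrite -[p]qreprK -[q]qreprK -qprojD -!qprojZ scalerDr qprojD.
Qed.
Fact qscaleDl q : {morph qscale^~ q : a b / a + b}.
Proof. by move=> a b /=; rewrite -[q]qreprK -!qprojZ scalerDl qprojD. Qed.

HB.instance Definition _ :=
  GRing.Zmodule_isLmodule.Build k quot_span qscaleA qscale1 qscaleDr qscaleDl.

Fact qproj_is_linear : linear qproj.
Proof. by move=> c x y; rewrite qprojD qprojZ. Qed.
HB.instance Definition _ :=
  GRing.isLinear.Build k V quot_span *:%R qproj qproj_is_linear.

End QuotSpan.
Arguments qproj {k V G} x.
Arguments qrepr {k V G} q.

Section Tensor.
Variables (k : fieldType) (A B : lmodType k).

Definition pairm (a : A) (b : B) : {malg k[(A * B)%type]} := << (a, b) >>.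

Inductive tensor_rel : {malg k[(A * B)%type]} -> Prop :=
| tensor_rel_l c a a' b :
    tensor_rel (pairm (c *: a + a') b - (c *: pairm a b + pairm a' b))
| tensor_rel_r c a b b' :
    tensor_rel (pairm a (c *: b + b') - (c *: pairm a b + pairm a b')).

Definition tensor : lmodType k := quot_span tensor_rel.

Definition tens (a : A) (b : B) : tensor := qproj (pairm a b).

Definition bilinear_fun (C : lmodType k) (f : A -> B -> C) : Prop :=
  (forall c a a' b, f (c *: a + a') b = c *: f a b + f a' b) /\
  (forall c a b b', f a (c *: b + b') = c *: f a b + f a b').

Lemma tens_bilinear : bilinear_fun tens.
Proof.
split=> [c a a' b|c a b b']; rewrite /tens -qproj_is_linear;
  apply: (proj2 (qprojP _ _ _)); apply: span_gen.
  exact: tensor_rel_l.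
exact: tensor_rel_r.
Qed.

Definition malg_lift (C : lmodType k) (f : A -> B -> C)
    (g : {malg k[(A * B)%type]}) : C :=
  \sum_(p <- msupp g) g@_p *: f p.1 p.2.

(* The map A ⊗ B -> C induced by f.  It is computed on a representative, so it
   is meaningful only when f is bilinear: see tliftE, tlift_linear and
   tensor_hom_ext for the universal property. *)
Definition tlift (C : lmodType k) (f : A -> B -> C) (t : tensor) : C :=
  malg_lift f (qrepr t).

Lemma malg_liftEw (C : lmodType k) (f : A -> B -> C) g (D : {fset (A * B)%type}) :
  fsubset (msupp g) D -> malg_lift f g = \sum_(p <- D) g@_p *: f p.1 p.2.
Proof.
move=> gD; rewrite /malg_lift (big_fset_incl _ gD) // => p _ pg.
by rewrite mcoeff_outdom ?scale0r.
Qed.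

Lemma malg_lift_linear (C : lmodType k) (f : A -> B -> C) : linear (malg_lift f).
Proof.
move=> c x y; pose D := (msupp x `|` msupp y `|` msupp (c *: x + y))%fset.
rewrite !(@malg_liftEw _ f _ D);
  try by apply/fsubsetP=> p pg; rewrite !inE pg ?orbT.
rewrite scaler_sumr -big_split /=; apply: eq_bigr => p _.
by rewrite mcoeffD mcoeffZ scalerDl scalerA.
Qed.

HB.instance Definition _ (C : lmodType k) (f : A -> B -> C) :=
  GRing.isLinear.Build k _ C *:%R (malg_lift f) (malg_lift_linear f).

Lemma malg_liftU (C : lmodType k) (f : A -> B -> C) a b :
  malg_lift f (pairm a b) = f a b.
Proof. by rewrite /malg_lift msuppU oner_eq0 big_seq_fset1 mcoeffUU scale1r. Qed.

Section Bilinear.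
Variables (C : lmodType k) (f : A -> B -> C) (fbil : bilinear_fun f).

Lemma malg_lift_rel x : span tensor_rel x -> malg_lift f x = 0.
Proof.
elim=> [|c u v Gu _ IH]; first exact: linear0.
rewrite malg_lift_linear IH addr0; case: Gu => [d a a' b|d a b b'];
  by rewrite linearB /= malg_lift_linear !malg_liftU (fbil.1, fbil.2) subrr scaler0.
Qed.

Lemma tlift_qproj x : tlift f (qproj x) = malg_lift f x.
Proof.
apply/eqP; rewrite -subr_eq0 /tlift -linearB; apply/eqP/malg_lift_rel.
by apply: (proj1 (qprojP _ _ _)); rewrite qreprK.
Qed.

Lemma tliftE a b : tlift f (tens a b) = f a b.
Proof. by rewrite tlift_qproj malg_liftU. Qed.

Lemma tlift_linear : linear (tlift f).
Proof.
move=> c s t; rewrite -[s]qreprK -[t]qreprK -qproj_is_linear !tlift_qproj.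
exact: malg_lift_linear.
Qed.

End Bilinear.

Lemma tlift_comb (C : lmodType k) (f g h : A -> B -> C) c t :
  (forall a b, h a b = c *: f a b + g a b) ->
  tlift h t = c *: tlift f t + tlift g t.
Proof.
move=> hfg; rewrite /tlift /malg_lift scaler_sumr -big_split /=.
apply: eq_bigr => p _.
by rewrite hfg scalerDr !scalerA [_ * c]mulrC.
Qed.

Lemma tensor_hom_ext (C : lmodType k) (f g : tensor -> C) :
  linear f -> linear g -> (forall a b, f (tens a b) = g (tens a b)) -> f =1 g.
Proof.
move=> flin glin fg t.
have f0 : f 0 = 0 by have := flin (-1) 0 0; rewrite scaler0 addr0 scaleN1r addNr.
have g0 : g 0 = 0 by have := glin (-1) 0 0; rewrite scaler0 addr0 scaleN1r addNr.
rewrite -[t]qreprK (monalgE (qrepr t)).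
elim: (msupp _ : seq _) => [|[a b] s IH]; first by rewrite big_nil linear0 f0 g0.
rewrite big_cons.
have -> : << (qrepr t)@_(a, b) *g (a, b) >> = (qrepr t)@_(a, b) *: pairm a b.
  by apply/malgP => p; rewrite mcoeffZ !mcoeffU mulrnAr mulr1.
by rewrite qproj_is_linear flin glin IH; congr (_ *: _ + _); exact: fg.
Qed.

End Tensor.
Arguments tens {k A B} a b.
Arguments tlift {k A B C} f t.

Section TensorMaps.
Variable k : fieldType.

Definition tensmap (A B C D : lmodType k) (f : A -> C) (g : B -> D) :
    tensor A B -> tensor C D :=
  tlift (fun a b => tens (f a) (g b)).

Definition tens_swap (A B : lmodType k) : tensor A B -> tensor B A :=
  tlift (fun a b => tens b a).

Definition tens_assoc (A B C : lmodType k) :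
    tensor (tensor A B) C -> tensor A (tensor B C) :=
  tlift (fun t c => tlift (fun a b => tens a (tens b c)) t).

(* (a ⊗ b) ⊗ (c ⊗ d) |-> (a ⊗ c) ⊗ (b ⊗ d) *)
Definition tens_mid (A B C D : lmodType k) :
    tensor (tensor A B) (tensor C D) -> tensor (tensor A C) (tensor B D) :=
  tlift (fun s t => tlift (fun a b =>
    tlift (fun c d => tens (tens a c) (tens b d)) t) s).

Section TensmapLinear.
Variables (A B C D : lmodType k) (f : {linear A -> C}) (g : {linear B -> D}).

Lemma tensmap_bilinear : bilinear_fun (fun a b => tens (f a) (g b)).
Proof.
have [l r] := tens_bilinear C D.
by split=> [c a a' b|c a b b']; rewrite linearP (l, r).
Qed.

Lemma tensmapE a b : tensmap f g (tens a b) = tens (f a) (g b).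
Proof. exact: tliftE tensmap_bilinear a b. Qed.

Lemma tensmap_linear : linear (tensmap f g).
Proof. exact: tlift_linear tensmap_bilinear. Qed.

Lemma tensmap0 : tensmap f g 0 = 0.
Proof.
by have := tensmap_linear (-1) 0 0; rewrite scaler0 addr0 scaleN1r addNr.
Qed.

End TensmapLinear.

Lemma tens_swapE (A B : lmodType k) (a : A) (b : B) : tens_swap (tens a b) = tens b a.
Proof.
apply: tliftE; have [l r] := tens_bilinear B A.
by split=> * /=; rewrite (l, r).
Qed.

Lemma tens_assocE (A B C : lmodType k) (a : A) (b : B) (c : C) :
  tens_assoc (tens (tens a b) c) = tens a (tens b c).
Proof.
have [l r] := tens_bilinear A (tensor B C); have [l' r'] := tens_bilinear B C.
have bil (c' : C) : bilinear_fun (fun (a : A) (b : B) => tens a (tens b c')).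
  by split=> * /=; rewrite ?l' (l, r).
rewrite /tens_assoc tliftE ?tliftE //; split=> [d t t' e|d t e e'].
  exact: tlift_linear (bil e) d t t'.
by apply: tlift_comb => a' b'; rewrite r' r.
Qed.

Lemma tens_midE (A B C D : lmodType k) (a : A) (b : B) (c : C) (d : D) :
  tens_mid (tens (tens a b) (tens c d)) = tens (tens a c) (tens b d).
Proof.
have [l r] := tens_bilinear (tensor A C) (tensor B D).
have [l1 r1] := tens_bilinear A C; have [l2 r2] := tens_bilinear B D.
have bil2 (a' : A) (b' : B) : bilinear_fun (fun (c : C) (d : D) => tens (tens a' c) (tens b' d)).
  by split=> * /=; rewrite ?r1 ?r2 (l, r).
have bil1 t : bilinear_fun (fun (a : A) (b : B) =>
    tlift (fun (c : C) (d : D) => tens (tens a c) (tens b d)) t).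
  by split=> [e u u' v|e u v v']; apply: tlift_comb => c' d'; rewrite ?l1 ?l2 (l, r).
rewrite /tens_mid tliftE ?tliftE //; split=> [e s s' t|e s t t'].
  exact: tlift_linear (bil1 t) e s s'.
by apply: tlift_comb => a' b'; exact: tlift_linear (bil2 a' b') e t t'.
Qed.

End TensorMaps.

Record bijection (I J : Type) := Bijection {
  bij_fun :> I -> J;
  bij_prf : bijective bij_fun }.

(* Bijections are compared pointwise, so that [sp_map] depends neither on the
   bijectivity proof nor on intensional details of the function. *)
Record species (k : fieldType) := Species {
  sp_obj :> finType -> lmodType k;
  sp_map : forall I J : finType, bijection I J -> {linear sp_obj I -> sp_obj J};
  sp_map_id : forall (I : finType) (s : bijection I I),
    s =1 id -> sp_map s =1 id;
  sp_map_comp : forall (I J K : finType)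
      (s : bijection I J) (t : bijection J K) (u : bijection I K),
    u =1 t \o s -> sp_map u =1 sp_map t \o sp_map s }.
Arguments sp_map {k} s {I J} _ : rename.

Record sp_morph (k : fieldType) (p q : species k) := SpMorph {
  sp_morph_fun :> forall I : finType, {linear p I -> q I};
  sp_morph_natural : forall (I J : finType) (s : bijection I J) (x : p I),
    sp_morph_fun J (sp_map p s x) = sp_map q s (sp_morph_fun I x) }.

Definition case_sum (I S T : Type) (f : S -> I) (g : T -> I) (u : S + T) : I :=
  match u with inl s => f s | inr t => g t end.

(* A decomposition I = S ⊔ T into two ordered, possibly empty, disjoint subsets.
   A subset of I is presented by an injection into I: bijectivity of [case_sum]
   says that the two maps are injective, with disjoint images covering I.  Any
   such datum is isomorphic to one where S and T are sigma types {x | x \in A} of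
   actual subsets of I, and naturality of the structure maps below makes them
   determined by their values on the latter; see [subset_decomp]. *)
Record decomp (I S T : finType) := Decomp {
  dl : S -> I;
  dr : T -> I;
  decomp_bij : bijective (case_sum dl dr) }.

Lemma decomp_sym_subproof (I S T : finType) (d : decomp I S T) :
  bijective (case_sum (dr d) (dl d)).
Proof.
have [g gK Kg] := decomp_bij d.
pose sw (A B : Type) (u : A + B) : B + A :=
  match u with inl a => inr a | inr b => inl b end.
by exists (@sw S T \o g) => [[t|s]|x] /=;
  [rewrite (gK (inr t))|rewrite (gK (inl s))|rewrite -[RHS]Kg; case: (g x)].
Qed.
Definition decomp_sym (I S T : finType) (d : decomp I S T) : decomp I T S :=
  Decomp (decomp_sym_subproof d).

Definition of_empty (I : Type) (v : void) : I := match v with end.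

Lemma decomp_void_r_subproof (I : finType) : bijective (case_sum id (@of_empty I)).
Proof. by exists inl => [[x|[]]|x]. Qed.
Definition decomp_void_r (I : finType) : decomp I I void :=
  Decomp (decomp_void_r_subproof I).
Definition decomp_void_l (I : finType) : decomp I void I :=
  decomp_sym (decomp_void_r I).

(* The two ways of refining I = R ⊔ S ⊔ T, with A = R ⊔ S and B = S ⊔ T. *)
Definition decomp_assoc (I A B R S T : finType)
    (d1 : decomp I A T) (d2 : decomp A R S)
    (e1 : decomp I R B) (e2 : decomp B S T) : Prop :=
  [/\ dl d1 \o dl d2 =1 dl e1,
      dl d1 \o dr d2 =1 dr e1 \o dl e2 &
      dr d1 =1 dr e1 \o dr e2].

(* I = S ⊔ T = S' ⊔ T', with S = A ⊔ B, T = C ⊔ D, S' = A ⊔ C and T' = B ⊔ D;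
   then A, B, C, D are the four intersections of S, T with S', T'. *)
Definition decomp_grid (I S T S' T' A B C D : finType)
    (d : decomp I S T) (e : decomp I S' T')
    (dS : decomp S A B) (dT : decomp T C D)
    (eS : decomp S' A C) (eT : decomp T' B D) : Prop :=
  [/\ dl d \o dl dS =1 dl e \o dl eS, dl d \o dr dS =1 dr e \o dl eT,
      dr d \o dl dT =1 dl e \o dr eS & dr d \o dr dT =1 dr e \o dr eT].

(* The bijection s : I -> I' carries d to d', inducing a and b on the parts. *)
Definition decomp_map (I S T I' S' T' : finType)
    (d : decomp I S T) (d' : decomp I' S' T')
    (s : I -> I') (a : S -> S') (b : T -> T') : Prop :=
  s \o dl d =1 dl d' \o a /\ s \o dr d =1 dr d' \o b.

(* The unit map k -> h[∅] is given by the image [sp_one] of 1. *)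
Record monoid_on (k : fieldType) (h : species k) := MonoidOn {
  mu : forall I S T : finType, decomp I S T -> {linear tensor (h S) (h T) -> h I};
  sp_one : h void;
  mu_natural : forall (I S T I' S' T' : finType)
      (d : decomp I S T) (d' : decomp I' S' T')
      (s : bijection I I') (a : bijection S S') (b : bijection T T'),
    decomp_map d d' s a b -> forall t : tensor (h S) (h T),
    sp_map h s (mu d t) = mu d' (tensmap (sp_map h a) (sp_map h b) t);
  muA : forall (I A B R S T : finType)
      (d1 : decomp I A T) (d2 : decomp A R S)
      (e1 : decomp I R B) (e2 : decomp B S T),
    decomp_assoc d1 d2 e1 e2 ->
    forall t : tensor (tensor (h R) (h S)) (h T),
    mu d1 (tensmap (mu d2) id t) = mu e1 (tensmap id (mu e2) (tens_assoc t));
  mu1l : forall (I : finType) (x : h I), mu (decomp_void_l I) (tens sp_one x) = x;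
  mu1r : forall (I : finType) (x : h I), mu (decomp_void_r I) (tens x sp_one) = x }.
Arguments mu {k h} m {I S T} d : rename.
Arguments sp_one {k h} m : rename.

Record comonoid_on (k : fieldType) (h : species k) := ComonoidOn {
  Delta : forall I S T : finType, decomp I S T -> {linear h I -> tensor (h S) (h T)};
  counit : {linear h void -> k^o};
  Delta_natural : forall (I S T I' S' T' : finType)
      (d : decomp I S T) (d' : decomp I' S' T')
      (s : bijection I I') (a : bijection S S') (b : bijection T T'),
    decomp_map d d' s a b -> forall x : h I,
    Delta d' (sp_map h s x) = tensmap (sp_map h a) (sp_map h b) (Delta d x);
  DeltaA : forall (I A B R S T : finType)
      (d1 : decomp I A T) (d2 : decomp A R S)
      (e1 : decomp I R B) (e2 : decomp B S T),
    decomp_assoc d1 d2 e1 e2 -> forall x : h I,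
    tens_assoc (tensmap (Delta d2) id (Delta d1 x)) = tensmap id (Delta e2) (Delta e1 x);
  Delta1l : forall (I : finType) (x : h I),
    tlift (fun (e : h void) (y : h I) => counit e *: y) (Delta (decomp_void_l I) x) = x;
  Delta1r : forall (I : finType) (x : h I),
    tlift (fun (y : h I) (e : h void) => counit e *: y) (Delta (decomp_void_r I) x) = x }.
Arguments Delta {k h} c {I S T} d : rename.
Arguments counit {k h} c : rename.

(* The last four axioms say that product and unit are morphisms of comonoids. *)
Record bimonoid (k : fieldType) := Bimonoid {
  bim_sp :> species k;
  bim_mon : monoid_on bim_sp;
  bim_comon : comonoid_on bim_sp;
  bim_Delta_mu : forall (I S T S' T' A B C D : finType)
      (d : decomp I S T) (e : decomp I S' T')
      (dS : decomp S A B) (dT : decomp T C D)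
      (eS : decomp S' A C) (eT : decomp T' B D),
    decomp_grid d e dS dT eS eT ->
    forall t : tensor (bim_sp S) (bim_sp T),
    Delta bim_comon e (mu bim_mon d t) =
    tensmap (mu bim_mon eS) (mu bim_mon eT)
      (tens_mid (tensmap (Delta bim_comon dS) (Delta bim_comon dT) t));
  bim_counit_mu : forall x y : bim_sp void,
    counit bim_comon (mu bim_mon (decomp_void_r void) (tens x y)) =
    counit bim_comon x * counit bim_comon y;
  bim_Delta_one :
    Delta bim_comon (decomp_void_r void) (sp_one bim_mon) =
    tens (sp_one bim_mon) (sp_one bim_mon);
  bim_counit_one : counit bim_comon (sp_one bim_mon) = 1 }.

Notation "\mu[ h ]_ d" := (mu (bim_mon h) d)
  (at level 8, h at level 200, d at level 2, format "\mu[ h ]_ d") : ring_scope.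
Notation "\Delta[ h ]_ d" := (Delta (bim_comon h) d)
  (at level 8, h at level 200, d at level 2, format "\Delta[ h ]_ d") : ring_scope.

Definition commutative_bimonoid (k : fieldType) (h : bimonoid k) : Prop :=
  forall (I S T : finType) (d : decomp I S T) (t : tensor (h S) (h T)),
    \mu[h]_d t = \mu[h]_(decomp_sym d) (tens_swap t).

Definition cocommutative_bimonoid (k : fieldType) (h : bimonoid k) : Prop :=
  forall (I S T : finType) (d : decomp I S T) (x : h I),
    \Delta[h]_(decomp_sym d) x = tens_swap (\Delta[h]_d x).

Definition dim_one (k : fieldType) (V : lmodType k) : Prop :=
  exists2 e : V, e != 0 & forall x : V, exists c : k, x = c *: e.

Definition connected_bimonoid (k : fieldType) (h : bimonoid k) : Prop :=
  dim_one (h void).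

Definition subset_type (I : finType) (A : {set I}) : finType := {x : I | x \in A}.

Definition subset_incl (I : finType) (A B : {set I}) (AB : A \subset B)
    (x : subset_type A) : subset_type B :=
  exist _ (val x) (subsetP AB _ (valP x)).

Section SubsetDecomp.
Variables (I : finType) (S T : {set I}) (dST : [disjoint S & T]).

Lemma subset_decomp_subproof : bijective
  (case_sum (subset_incl (subsetUl S T)) (subset_incl (subsetUr S T))).
Proof.
have nST x : x \in S -> x \in T -> False by move=> xS; rewrite (disjointFr dST xS).
apply: inj_card_bij.
  move=> [[x xA]|[x xA]] [[y yA]|[y yA]] /(congr1 val) /= xy; subst y.
  - by congr inl; apply: val_inj.
  - by case: (nST x).
  - by case: (nST x).
  - by congr inr; apply: val_inj.
rewrite card_sum !card_sig.
exact: leq_card_setU.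
Qed.

Definition subset_decomp :
    decomp (subset_type (S :|: T)) (subset_type S) (subset_type T) :=
  Decomp subset_decomp_subproof.

End SubsetDecomp.

(* Nonempty sequences of subsets are given by head S and tail F. *)
Section BlockSequences.
Variable I : finType.
Implicit Types (S T : {set I}) (F : seq {set I}).

Definition disjoint_sets S T : bool := [disjoint S & T].

Definition disjoint_blocks S F : bool := pairwise disjoint_sets (S :: F).

Fixpoint blocks_union S F : {set I} :=
  if F is T :: F' then S :|: blocks_union T F' else S.

Lemma blocks_unionE S F : blocks_union S F = \bigcup_(T <- S :: F) T.
Proof.
by elim: F S => [|T F IH] S; rewrite big_cons ?big_nil ?setU0 //= IH.
Qed.

Lemma disjoint_blocks_head S T F :
  disjoint_blocks S (T :: F) -> [disjoint S & blocks_union T F].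
Proof.
case/andP=> SF _.
elim: F T SF => [|T' F IH] T /=; first by rewrite andbT.
case/andP=> ST SF; rewrite disjoints_subset setCU subsetI -!disjoints_subset.
by apply/andP; split; [exact: ST | exact: IH].
Qed.

Lemma disjoint_blocks_tail S T F :
  disjoint_blocks S (T :: F) -> disjoint_blocks T F.
Proof. by case/andP. Qed.

End BlockSequences.

Section IteratedMaps.
Variables (k : fieldType) (h : bimonoid k) (I : finType).
Implicit Types (S T : {set I}) (F : seq {set I}).

(* h[S] ⊗ (h[T] ⊗ (... )) for the blocks S, T, ... *)
Fixpoint blocks_tensor S F : lmodType k :=
  if F is T :: F' then tensor (h (subset_type S)) (blocks_tensor T F')
  else h (subset_type S).

Fixpoint mu_blocks S F : disjoint_blocks S F ->
    blocks_tensor S F -> h (subset_type (blocks_union S F)) :=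
  match F with
  | [::] => fun _ x => x
  | T :: F' => fun dF t =>
      \mu[h]_(subset_decomp (disjoint_blocks_head dF))
        (tensmap id (mu_blocks (disjoint_blocks_tail dF)) t)
  end.

Fixpoint Delta_blocks S F : disjoint_blocks S F ->
    h (subset_type (blocks_union S F)) -> blocks_tensor S F :=
  match F with
  | [::] => fun _ x => x
  | T :: F' => fun dF x =>
      tensmap id (Delta_blocks (disjoint_blocks_tail dF))
        (\Delta[h]_(subset_decomp (disjoint_blocks_head dF)) x)
  end.

End IteratedMaps.

Section Full.
Variables (I : finType) (A : {set I}) (fullA : A = [set: I]).

Definition full_sub (x : I) : subset_type A :=
  exist _ x (eq_ind_r (fun B : {set I} => x \in B) (in_setT x) fullA).

Lemma full_valK : cancel (val : subset_type A -> I) full_sub.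
Proof. by move=> x; apply: val_inj. Qed.

Definition full_val_bij : bijection (subset_type A) I :=
  @Bijection _ _ val (Bijective full_valK (fun _ => erefl)).
Definition full_sub_bij : bijection I (subset_type A) :=
  @Bijection _ _ full_sub (Bijective (fun _ => erefl) full_valK).

End Full.

Definition is_composition (I : finType) (F : seq {set I}) : bool :=
  [&& all (fun S => S != set0) F, pairwise (@disjoint_sets I) F
    & \bigcup_(S <- F) S == [set: I]].

(* Compositions F = (I_1, ..., I_l) of I with l = n + 1 blocks. *)
Definition composition (I : finType) (n : nat) : finType :=
  {F : n.+1.-tuple {set I} | is_composition F}.

Section CompositionMaps.
Variables (k : fieldType) (h : bimonoid k) (I : finType) (n : nat).
Variable F : composition I n.

Definition first_block : {set I} := thead (val F).
Definition other_blocks : seq {set I} := behead (val F).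

Lemma blocksE : first_block :: other_blocks = val F.
Proof. by rewrite /first_block /other_blocks; case/tupleP: (val F). Qed.

Lemma composition_disjoint : disjoint_blocks first_block other_blocks.
Proof. by rewrite /disjoint_blocks blocksE; have /and3P[] := valP F. Qed.

Lemma composition_full : blocks_union first_block other_blocks = [set: I].
Proof. by rewrite blocks_unionE blocksE; have /and3P[_ _ /eqP] := valP F. Qed.

Definition comp_tensor : lmodType k := blocks_tensor h first_block other_blocks.

Definition mu_comp (t : comp_tensor) : h I :=
  sp_map h (full_val_bij composition_full) (mu_blocks composition_disjoint t).

Definition Delta_comp (x : h I) : comp_tensor :=
  Delta_blocks composition_disjoint (sp_map h (full_sub_bij composition_full) x).

End CompositionMaps.

(* A composition of I has at most #|I| blocks, so all compositions are counted.
   The sum is empty, hence the value is 0, when I is empty. *)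
Definition log_id (k : fieldType) (h : bimonoid k) (I : finType) (x : h I) : h I :=
  \sum_(n < #|I|) \sum_(F : composition I n)
    ((-1) ^+ n / n.+1%:R) *: mu_comp (Delta_comp F x).

Section Primitive.
Variables (k : fieldType) (h : bimonoid k).

Definition primitive (I : finType) (x : h I) : Prop :=
  (#|I| = 0%N -> x = 0) /\
  forall (S T : finType) (d : decomp I S T),
    (0 < #|S|)%N -> (0 < #|T|)%N -> \Delta[h]_d x = 0.

Definition primitive_pred (I : finType) : {pred h I} := fun x => `[< primitive x >].

Lemma primitive_submod_closed (I : finType) : submod_closed (@primitive_pred I).
Proof.
split; first by apply/asboolP; split=> // *; rewrite linear0.
move=> a x y /asboolP[x0 xP] /asboolP[y0 yP]; apply/asboolP; split=> [I0|S T d S0 T0].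
  by rewrite x0 // y0 // scaler0 addr0.
by rewrite linearP xP // yP // scaler0 addr0.
Qed.

HB.instance Definition _ (I : finType) :=
  GRing.isSubmodClosed.Build k (h I) (@primitive_pred I) (primitive_submod_closed I).

Definition prim_obj (I : finType) : Type := {x : h I | x \in @primitive_pred I}.
HB.instance Definition _ I := SubChoice.on (prim_obj I).
HB.instance Definition _ I := [SubChoice_isSubLmodule of prim_obj I by <:].

Lemma sp_map_primitive (I J : finType) (s : bijection I J) (x : h I) :
  primitive x -> primitive (sp_map h s x).
Proof.
case=> x0 xP; split=> [J0|S T d S0 T0].
  by rewrite x0 ?linear0 // (bij_eq_card (bij_prf s)).
have [s' sK s'K] := bij_prf s; have [g gK Kg] := decomp_bij d.
have bij : bijective (case_sum (s' \o dl d) (s' \o dr d)).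
  exists (g \o s) => [[u|u]|u] /=; rewrite ?s'K.
  - exact: (gK (inl u)).
  - exact: (gK (inr u)).
  - by have := Kg (s u); case: (g (s u)) => v /= ->; rewrite sK.
pose idS := @Bijection S S id (Bijective (fun _ => erefl) (fun _ => erefl)).
pose idT := @Bijection T T id (Bijective (fun _ => erefl) (fun _ => erefl)).
rewrite (@Delta_natural _ _ _ _ _ _ _ _ _ (Decomp bij) d s idS idT).
  by rewrite xP // tensmap0.
by split=> u /=; rewrite s'K.
Qed.

Definition prim_map (I J : finType) (s : bijection I J) (x : prim_obj I) : prim_obj J :=
  exist _ (sp_map h s (val x))
    (asboolT (sp_map_primitive s (asboolW (valP x)))).

Lemma prim_map_linear (I J : finType) (s : bijection I J) : linear (prim_map s).
Proof. by move=> a x y; apply: val_inj; rewrite /= !linearP. Qed.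
HB.instance Definition _ (I J : finType) (s : bijection I J) :=
  GRing.isLinear.Build k (prim_obj I) (prim_obj J) *:%R (prim_map s)
    (prim_map_linear s).

Lemma prim_map_id (I : finType) (s : bijection I I) :
  s =1 id -> prim_map s =1 id.
Proof. by move=> s1 x; apply: val_inj; rewrite /= (sp_map_id s1). Qed.

Lemma prim_map_comp (I J K : finType)
    (s : bijection I J) (t : bijection J K) (u : bijection I K) :
  u =1 t \o s -> prim_map u =1 prim_map t \o prim_map s.
Proof. by move=> uts x; apply: val_inj; rewrite /= (sp_map_comp uts). Qed.

Definition prim_species : species k :=
  @Species k (fun I => prim_obj I) (fun I J s => prim_map s) prim_map_id prim_map_comp.

Definition prim_incl_fun (I : finType) (x : prim_species I) : h I := val (x : prim_obj I).
Lemma prim_incl_linear (I : finType) : linear (@prim_incl_fun I).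
Proof. by []. Qed.
HB.instance Definition _ (I : finType) :=
  GRing.isLinear.Build k (prim_species I) (h I) *:%R (@prim_incl_fun I)
    (@prim_incl_linear I).

Definition prim_incl : sp_morph prim_species h :=
  @SpMorph k prim_species h (fun I => @prim_incl_fun I) (fun _ _ _ _ => erefl).

End Primitive.

Section Indecomposable.
Variables (k : fieldType) (h : bimonoid k).

(* Generators of the subspace by which h[I] is divided: everything if I is
   empty, and otherwise the union of the images of the products. *)
Definition decomposable (I : finType) (x : h I) : Prop :=
  #|I| = 0%N \/
  exists (S T : finType) (d : decomp I S T) (t : tensor (h S) (h T)),
    [/\ (0 < #|S|)%N, (0 < #|T|)%N & x = \mu[h]_d t].

Definition indec_obj (I : finType) : lmodType k := quot_span (@decomposable I).

Lemma sp_map_decomposable (I J : finType) (s : bijection I J) (x : h I) :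
  decomposable x -> decomposable (sp_map h s x).
Proof.
case=> [I0|[S [T [d [t [S0 T0 ->]]]]]].
  by left; rewrite -(bij_eq_card (bij_prf s)).
right; have [s' sK s'K] := bij_prf s; have [g gK Kg] := decomp_bij d.
have bij : bijective (case_sum (s \o dl d) (s \o dr d)).
  exists (g \o s') => [[u|u]|u] /=; rewrite ?sK.
  - exact: (gK (inl u)).
  - exact: (gK (inr u)).
  - by have := Kg (s' u); case: (g (s' u)) => v /= ->; rewrite s'K.
pose idS := @Bijection S S id (Bijective (fun _ => erefl) (fun _ => erefl)).
pose idT := @Bijection T T id (Bijective (fun _ => erefl) (fun _ => erefl)).
exists S, T, (Decomp bij), (tensmap (sp_map h idS) (sp_map h idT) t).
by split=> //; apply: mu_natural.
Qed.

Definition indec_map (I J : finType) (s : bijection I J) (q : indec_obj I) :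
    indec_obj J :=
  qproj (sp_map h s (qrepr q)).

Lemma indec_map_qproj (I J : finType) (s : bijection I J) (x : h I) :
  indec_map s (qproj x) = qproj (sp_map h s x).
Proof.
apply: (proj2 (qprojP _ _ _)); rewrite -linearB.
apply: (span_map (G := @decomposable I)).
  by move=> y yD; apply: span_gen; exact: sp_map_decomposable.
by apply: (proj1 (qprojP _ _ _)); rewrite qreprK.
Qed.

Lemma indec_map_linear (I J : finType) (s : bijection I J) : linear (indec_map s).
Proof.
move=> a p q; rewrite -[p]qreprK -[q]qreprK -qproj_is_linear !indec_map_qproj.
by rewrite linearP qproj_is_linear.
Qed.
HB.instance Definition _ (I J : finType) (s : bijection I J) :=
  GRing.isLinear.Build k (indec_obj I) (indec_obj J) *:%R (indec_map s)
    (indec_map_linear s).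

Lemma indec_map_id (I : finType) (s : bijection I I) :
  s =1 id -> indec_map s =1 id.
Proof.
by move=> s1 q; rewrite -[q in LHS]qreprK indec_map_qproj (sp_map_id s1) qreprK.
Qed.

Lemma indec_map_comp (I J K : finType)
    (s : bijection I J) (t : bijection J K) (u : bijection I K) :
  u =1 t \o s -> indec_map u =1 indec_map t \o indec_map s.
Proof.
move=> uts q; rewrite -[q]qreprK /= !indec_map_qproj.
by rewrite (sp_map_comp uts).
Qed.

Definition indec_species : species k :=
  @Species k indec_obj (fun I J s => indec_map s) indec_map_id indec_map_comp.

Lemma qproj_natural (I J : finType) (s : bijection I J) (x : h I) :
  qproj (sp_map h s x) = sp_map indec_species s (qproj x) :> indec_species J.
Proof. by rewrite /= indec_map_qproj. Qed.

Definition indec_proj : sp_morph h indec_species :=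
  @SpMorph k h indec_species (fun I => (qproj : {linear h I -> indec_obj I}))
    qproj_natural.

End Indecomposable.

(* Main.v *)
(* Let psi_n be the n-th convolution power of id, and Q_j that of id - iota o
   epsilon, which is the sum of mu_F Delta_F over the compositions F of length j.
   By the binomial theorem psi_n = sum_j C(n, j) Q_j, and Q_j vanishes on h[I] for
   j > #|I|; so psi_n is polynomial in n on each h[I], without constant term if I
   is nonempty, and its coefficient of n is log(id).  If h is commutative, psi_n is
   multiplicative: psi_n o mu_{S,T} = mu_{S,T} o (psi_n (x) psi_n).  For S and T
   nonempty the right-hand side is divisible by n^2, so comparing coefficients of n
   gives log(id) o mu_{S,T} = 0; the cocommutative case is dual.  Finally mu_F
   Delta_F kills primitives and has decomposable image when F has length at least 2,
   and it is the identity for length 1. *)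
Require Import Defs.
From mathcomp Require Import all_boot all_algebra.
From mathcomp Require Import finmap boolp monalg.
From HB Require Import structures.

Set Implicit Arguments.
Unset Strict Implicit.
Unset Printing Implicit Defensive.

Import GRing.Theory.
Local Open Scope ring_scope.

(** * Tensor products *)

Section Tensors.
Variable k : fieldType.
Implicit Types A B C D E F : lmodType k.

(** Multiplicativity of psi_n is an induction on psi_{n+1} = id * psi_n. A subset of I = S ⊔ T is a
    pair of subsets of S and T, so the sums on both sides match term by term. In each term the
    bimonoid axiom rewrites Delta o mu on the resulting 2 x 2 grid of blocks; what remains is to
    regroup a fourfold product by exchanging its two middle factors, and this is where commutativity
    acts. The parts of a decomposition are arbitrary finite types, so convolution is a sum over
    subsets that can be re-indexed by any suitable family of decompositions; this rests on
    naturality. Connectedness says that iota o epsilon is the identity of h[∅]. Hence convolution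
    terms with an empty part are trivial, which gives psi_{n+1} = psi_n + (id - iota o epsilon) *
    psi_n and Q_1 = id on nonempty sets. The coefficient of n is read off from values at natural
    numbers: in characteristic 0 it is a fixed linear combination of the values at 0, ..., N - 1, so
    it makes sense for values in any vector space. The coefficients of the logarithm series appear
    because C(X, j) has linear coefficient (-1)^(j-1)/j. *)

Lemma bilinear_linear_r A B C (f : A -> B -> C) a : bilinear_fun f -> linear (f a).
Proof. by case=> _ fr c b b'; exact: fr. Qed.

Lemma tensDr A B (a : A) (b b' : B) : tens a (b + b') = tens a b + tens a b'.
Proof. by have [_ r] := tens_bilinear A B; rewrite -[b]scale1r r !scale1r. Qed.

Lemma tensDl A B (a a' : A) (b : B) : tens (a + a') b = tens a b + tens a' b.
Proof. by have [l _] := tens_bilinear A B; rewrite -[a]scale1r l !scale1r. Qed.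

Lemma tens0r A B (a : A) : tens a (0 : B) = 0.
Proof. by apply: (addrI (tens a 0)); rewrite -tensDr !addr0. Qed.

Lemma tens0l A B (b : B) : tens (0 : A) b = 0.
Proof. by apply: (addrI (tens 0 b)); rewrite -tensDl !addr0. Qed.

Lemma tensZr A B c (a : A) (b : B) : tens a (c *: b) = c *: tens a b.
Proof. by have [_ r] := tens_bilinear A B; rewrite -[c *: b]addr0 r tens0r addr0. Qed.

Lemma tensZl A B c (a : A) (b : B) : tens (c *: a) b = c *: tens a b.
Proof. by have [l _] := tens_bilinear A B; rewrite -[c *: a]addr0 l tens0l addr0. Qed.

HB.instance Definition _ A B (a : A) :=
  GRing.isLinear.Build k B (tensor A B) *:%R (tens a)
    (bilinear_linear_r a (tens_bilinear A B)).

HB.instance Definition _ A B C D (f : {linear A -> C}) (g : {linear B -> D}) :=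
  GRing.isLinear.Build k (tensor A B) (tensor C D) *:%R (tensmap f g)
    (tensmap_linear f g).

(** Scalars are absorbed into the left factor, so sums of pure tensors exhaust the tensor
    product. *)
Lemma tens_ind A B (P : tensor A B -> Prop) :
  P 0 -> (forall a b t, P t -> P (tens a b + t)) -> forall t, P t.
Proof.
move=> P0 PD t; rewrite -[t]qreprK (monalgE (qrepr t)).
elim: (msupp _ : seq _) => [|[a b] s IH]; first by rewrite big_nil linear0.
rewrite big_cons.
set c := mcoeff _ _; rewrite linearD /=.
have -> : mkmalgU (a, b) c = c *: pairm a b :> malg _ _.
  by apply/malgP => p; rewrite mcoeffZ !mcoeffU mulrnAr mulr1.
rewrite linearZ /= -[c *: _]/(c *: tens a b) -tensZl; exact: PD.
Qed.

Lemma tensmap_ext A B C D (f f' : A -> C) (g g' : B -> D) :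
  f =1 f' -> g =1 g' -> tensmap f g =1 tensmap f' g'.
Proof. by move=> /funext-> /funext->. Qed.

(** Holds for every function [h], bilinear or not: [tlift] is a finite sum over a chosen
    representative, and only the outer map has to respect it. For the same reason the inner maps of
    [tensmap_comp], [tensmap_sumr] and [tensmap_suml] are bare functions. *)
Lemma linear_tlift A B C D (f : {linear C -> D}) (h : A -> B -> C) t :
  f (tlift h t) = tlift (fun a b => f (h a b)) t.
Proof.
by rewrite /tlift /malg_lift linear_sum; apply: eq_bigr => p _; rewrite linearZ.
Qed.

Lemma tensmap_comp A B C D E F (f : A -> C) (g : B -> D)
    (f' : {linear C -> E}) (g' : {linear D -> F}) t :
  tensmap f' g' (tensmap f g t) = tensmap (f' \o f) (g' \o g) t.
Proof.
etransitivity; first exact: (@linear_tlift _ _ _ _ (tensmap f' g')).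
congr (tlift _ t); apply/funext => a; apply/funext => b; exact: tensmapE.
Qed.

Lemma tensmap_sumr A B C D (f : A -> C) (J : Type) (r : seq J) (P : pred J)
    (c : J -> k) (g : J -> B -> D) t :
  tensmap f (fun b => \sum_(j <- r | P j) c j *: g j b) t =
  \sum_(j <- r | P j) c j *: tensmap f (g j) t.
Proof.
rewrite /tensmap /tlift /malg_lift.
under [RHS]eq_bigr do rewrite scaler_sumr.
rewrite exchange_big; apply: eq_bigr => p _ /=.
rewrite linear_sum scaler_sumr; apply: eq_bigr => j _ /=.
by rewrite linearZ /= !scalerA mulrC.
Qed.

Lemma tensmap_suml A B C D (f : B -> D) (J : Type) (r : seq J) (P : pred J)
    (c : J -> k) (g : J -> A -> C) t :
  tensmap (fun b => \sum_(j <- r | P j) c j *: g j b) f t =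
  \sum_(j <- r | P j) c j *: tensmap (g j) f t.
Proof.
rewrite /tensmap /tlift /malg_lift.
under [RHS]eq_bigr do rewrite scaler_sumr.
rewrite exchange_big; apply: eq_bigr => p _ /=.
rewrite (big_morph (fun a => tens a (f p.2)) (fun a a' => tensDl a a' _) (tens0l _ _)).
rewrite scaler_sumr; apply: eq_bigr => j _ /=.
by rewrite tensZl !scalerA mulrC.
Qed.

Lemma tensmap0l A B C D (f : B -> D) (t : tensor A B) :
  tensmap (fun=> 0 : C) f t = 0.
Proof.
(* The zero function is an empty linear combination. *)
have -> : (fun a : A => 0 : C) = fun a => \sum_(j : 'I_0) 0 *: (0 : C).
  by apply/funext => a; rewrite big_ord0.
by apply: etrans (tensmap_suml _ _ _ _ _ _) _; rewrite big_ord0.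
Qed.

Lemma tensmap0r A B C D (f : A -> C) (t : tensor A B) :
  tensmap f (fun=> 0 : D) t = 0.
Proof.
have -> : (fun a : B => 0 : D) = fun a => \sum_(j : 'I_0) 0 *: (0 : D).
  by apply/funext => a; rewrite big_ord0.
by apply: etrans (tensmap_sumr _ _ _ _ _ _) _; rewrite big_ord0.
Qed.

Local Opaque tensor tens tlift tensmap tens_swap tens_assoc tens_mid.

Lemma tens_swap_linear A B : linear (@tens_swap k A B).
Proof.
apply: tlift_linear; have [l r] := tens_bilinear B A.
by split=> * /=; rewrite (l, r).
Qed.
HB.instance Definition _ A B :=
  GRing.isLinear.Build k _ _ *:%R (@tens_swap k A B) (@tens_swap_linear A B).

Lemma tens_mid_linear A B C D : linear (@tens_mid k A B C D).
Proof.
have bil2 (a : A) (b : B) :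
    bilinear_fun (fun (c : C) (d : D) => tens (tens a c) (tens b d)).
  by split=> * /=; rewrite ?tensDr ?tensZr // tensDl tensZl.
apply: tlift_linear; split=> [e s s' t|e s t t'].
  apply: tlift_linear; split=> [x u u' v|x u v v']; apply: tlift_comb => c d.
    by rewrite tensDl tensZl tensDl tensZl.
  by rewrite tensDl tensZl tensDr tensZr.
by apply: tlift_comb => a b; exact: tlift_linear (bil2 a b) e t t'.
Qed.
HB.instance Definition _ A B C D :=
  GRing.isLinear.Build k _ _ *:%R (@tens_mid k A B C D) (@tens_mid_linear A B C D).

Lemma tens_assoc_linear A B C : linear (@tens_assoc k A B C).
Proof.
apply: tlift_linear; split=> [x u u' v|x u v v'].
  apply: tlift_linear; split=> * /=; first by rewrite tensDl tensZl.
  by rewrite tensDl tensZl tensDr tensZr.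
by apply: tlift_comb => a b; rewrite !(tensDr,tensZr).
Qed.
HB.instance Definition _ A B C :=
  GRing.isLinear.Build k _ _ *:%R (@tens_assoc k A B C) (@tens_assoc_linear A B C).

(** Inverse of [tens_assoc]; it allows coassociativity, stated with [tens_assoc] on one side, to be
    solved for the left-bracketed coproduct. *)
Definition tens_unassoc A B C : tensor A (tensor B C) -> tensor (tensor A B) C :=
  tlift (fun a t => tlift (fun b c => tens (tens a b) c) t).

Lemma tens_unassoc_bil A B C (a : A) :
  bilinear_fun (fun (b : B) (c : C) => tens (tens a b) c).
Proof. by split=> * /=; rewrite ?tensDr ?tensZr // tensDl tensZl. Qed.

Lemma tens_unassoc_bilinear A B C : bilinear_fun
  (fun (a : A) (t : tensor B C) => tlift (fun b c => tens (tens a b) c) t).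
Proof.
split=> [x a a' t|x a t t'].
  by apply: tlift_comb => b c; rewrite !(tensDl, tensZl).
exact: tlift_linear (tens_unassoc_bil B C a) x t t'.
Qed.

HB.instance Definition _ A B C :=
  GRing.isLinear.Build k _ _ *:%R (@tens_unassoc A B C)
    (tlift_linear (@tens_unassoc_bilinear A B C)).

Lemma tens_unassocE A B C (a : A) (b : B) (c : C) :
  tens_unassoc (tens a (tens b c)) = tens (tens a b) c.
Proof.
rewrite /tens_unassoc (tliftE (@tens_unassoc_bilinear A B C)).
exact: tliftE (tens_unassoc_bil B C a) b c.
Qed.

Lemma tens_ext A B C (f g : {linear tensor A B -> C}) :
  (forall a b, f (tens a b) = g (tens a b)) -> f =1 g.
Proof. by apply: tensor_hom_ext => c x y; exact: linearP. Qed.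

Lemma tens_ext3l A B C D (f g : {linear tensor (tensor A B) C -> D}) :
  (forall a b c, f (tens (tens a b) c) = g (tens (tens a b) c)) -> f =1 g.
Proof.
move=> fg; apply: tens_ext => s c.
elim/tens_ind: s => [|a b s IH]; first by rewrite tens0l !linear0.
by rewrite tensDl linearD (linearD g); congr (_ + _); [exact: fg|exact: IH].
Qed.

Lemma tens_ext3r A B C D (f g : {linear tensor A (tensor B C) -> D}) :
  (forall a b c, f (tens a (tens b c)) = g (tens a (tens b c))) -> f =1 g.
Proof.
move=> fg; apply: tens_ext => a s.
elim/tens_ind: s => [|b c s IH]; first by rewrite tens0r !linear0.
by rewrite tensDr linearD (linearD g); congr (_ + _); [exact: fg|exact: IH].
Qed.

Lemma tens_ext4 A B C D E (f g : {linear tensor (tensor A B) (tensor C D) -> E}) :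
  (forall a b c d, f (tens (tens a b) (tens c d)) = g (tens (tens a b) (tens c d))) ->
  f =1 g.
Proof.
move=> fg; apply: tens_ext3l => a b t.
elim/tens_ind: t => [|c d t IH]; first by rewrite tens0r !linear0.
by rewrite tensDr linearD (linearD g); congr (_ + _); [exact: fg|exact: IH].
Qed.

Lemma tens_hom_ext4 A B C D E (f g : tensor (tensor A B) (tensor C D) -> E) :
  linear f -> linear g ->
  (forall a b c d, f (tens (tens a b) (tens c d)) = g (tens (tens a b) (tens c d))) ->
  f =1 g.
Proof.
move=> flin glin.
pose F : {linear _ -> _} := HB.pack f (GRing.isLinear.Build _ _ _ _ f flin).
pose G : {linear _ -> _} := HB.pack g (GRing.isLinear.Build _ _ _ _ g glin).
exact: (tens_ext4 (f := F) (g := G)).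
Qed.

Lemma tens_ext4m A B C D E (f g : {linear tensor A (tensor (tensor B C) D) -> E}) :
  (forall a b c d, f (tens a (tens (tens b c) d)) = g (tens a (tens (tens b c) d))) ->
  f =1 g.
Proof.
move=> fg; apply: tens_ext3r => a t d.
elim/tens_ind: t => [|b c t IH]; first by rewrite tens0l tens0r !linear0.
by rewrite tensDl tensDr linearD (linearD g); congr (_ + _); [exact: fg|exact: IH].
Qed.

Lemma tens_assocK A B C : cancel (@tens_assoc k A B C) (@tens_unassoc A B C).
Proof.
apply: (@tens_ext3l _ _ _ _ (@tens_unassoc A B C \o @tens_assoc k A B C) idfun).
by move=> a b c; exact: etrans (congr1 _ (tens_assocE _ _ _)) (tens_unassocE _ _ _).
Qed.

Lemma tensmap_id A B (t : tensor A B) : tensmap idfun idfun t = t.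
Proof.
apply: (@tens_ext _ _ _ (tensmap idfun idfun) idfun) => a b.
exact: (tensmapE idfun idfun).
Qed.

Lemma tensmapE2l A B C A' B' C'
    (f : {linear A -> A'}) (g : {linear B -> B'}) (p : {linear C -> C'}) a b c :
  tensmap (tensmap f g) p (tens (tens a b) c) = tens (tens (f a) (g b)) (p c).
Proof. exact: etrans (tensmapE _ _ _ _) (congr1 (tens^~ _) (tensmapE _ _ _ _)). Qed.

Lemma tensmapE2r A B C A' B' C'
    (f : {linear A -> A'}) (g : {linear B -> B'}) (p : {linear C -> C'}) a b c :
  tensmap f (tensmap g p) (tens a (tens b c)) = tens (f a) (tens (g b) (p c)).
Proof. exact: etrans (tensmapE _ _ _ _) (congr1 (tens _) (tensmapE _ _ _ _)). Qed.

Lemma tensmapE2 A B C D A' B' C' D'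
    (f : {linear A -> A'}) (g : {linear B -> B'})
    (p : {linear C -> C'}) (q : {linear D -> D'}) a b c d :
  tensmap (tensmap f g) (tensmap p q) (tens (tens a b) (tens c d)) =
  tens (tens (f a) (g b)) (tens (p c) (q d)).
Proof.
exact: etrans (tensmapE _ _ _ _) (congr2 tens (tensmapE _ _ _ _) (tensmapE _ _ _ _)).
Qed.

Lemma tens_mid_natural A B C D A' B' C' D'
    (f : {linear A -> A'}) (g : {linear B -> B'})
    (p : {linear C -> C'}) (q : {linear D -> D'}) t :
  tens_mid (tensmap (tensmap f g) (tensmap p q) t) =
  tensmap (tensmap f p) (tensmap g q) (tens_mid t).
Proof.
apply: (@tens_ext4 _ _ _ _ _
  (@tens_mid k A' B' C' D' \o tensmap (tensmap f g) (tensmap p q))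
  (tensmap (tensmap f p) (tensmap g q) \o @tens_mid k A B C D)) => a b c d.
transitivity (tens (tens (f a) (p c)) (tens (g b) (q d))).
  exact: etrans (congr1 _ (tensmapE2 _ _ _ _ _ _ _ _)) (tens_midE _ _ _ _).
exact: esym (etrans (congr1 _ (tens_midE _ _ _ _)) (tensmapE2 _ _ _ _ _ _ _ _)).
Qed.

Lemma tens_unassoc_natural A B C A' B' C'
    (f : {linear A -> A'}) (g : {linear B -> B'}) (p : {linear C -> C'}) t :
  tens_unassoc (tensmap f (tensmap g p) t) =
  tensmap (tensmap f g) p (tens_unassoc t).
Proof.
apply: (@tens_ext3r _ _ _ _
  (@tens_unassoc A' B' C' \o tensmap f (tensmap g p))
  (tensmap (tensmap f g) p \o @tens_unassoc A B C)) => a b c.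
transitivity (tens (tens (f a) (g b)) (p c)).
  exact: etrans (congr1 _ (tensmapE2r _ _ _ _ _ _)) (tens_unassocE _ _ _).
exact: esym (etrans (congr1 _ (tens_unassocE _ _ _)) (tensmapE2l _ _ _ _ _ _)).
Qed.

(* a ⊗ ((b ⊗ c) ⊗ d) |-> (a ⊗ b) ⊗ (c ⊗ d) *)
Definition tens_rebracket A B C D :
    tensor A (tensor (tensor B C) D) -> tensor (tensor A B) (tensor C D) :=
  @tens_unassoc A B (tensor C D) \o tensmap idfun (@tens_assoc k B C D).
HB.instance Definition _ A B C D := GRing.Linear.copy (@tens_rebracket A B C D)
  (@tens_unassoc A B (tensor C D) \o tensmap idfun (@tens_assoc k B C D)).

Lemma tens_rebracketE A B C D (a : A) (b : B) (c : C) (d : D) :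
  tens_rebracket (tens a (tens (tens b c) d)) = tens (tens a b) (tens c d).
Proof.
apply: (etrans _ (tens_unassocE _ _ _)); apply: (congr1 (@tens_unassoc A B (tensor C D))).
exact: etrans (tensmapE _ _ _ _) (congr1 (tens _) (tens_assocE _ _ _)).
Qed.

(** Once [b] and [c] are bracketed together, the middle exchange is a plain swap. This brings
    [Delta_interchange] into a shape to which cocommutativity applies. *)
Lemma tens_mid_rebracket A B C D (t : tensor A (tensor (tensor B C) D)) :
  tens_mid (tens_rebracket (tensmap idfun (tensmap (@tens_swap k B C) idfun) t)) =
  tens_rebracket t.
Proof.
apply: (@tens_ext4m _ _ _ _ _
  (@tens_mid k A C B D \o @tens_rebracket A C B D \o
   tensmap idfun (tensmap (@tens_swap k B C) idfun))
  (@tens_rebracket A B C D)) => a b c d.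
transitivity (tens (tens a b) (tens c d)); last exact: esym (tens_rebracketE _ _ _ _).
apply: (etrans _ (tens_midE _ _ _ _)); apply: (congr1 (@tens_mid k A C B D)).
apply: (etrans _ (tens_rebracketE _ _ _ _)); apply: (congr1 (@tens_rebracket A C B D)).
apply: etrans (tensmapE _ _ _ _) _; apply: (congr1 (tens a)).
exact: etrans (tensmapE _ _ _ _) (congr1 (tens^~ _) (tens_swapE _ _)).
Qed.

End Tensors.

(** * Decompositions of finite sets *)

Section Decompositions.
Implicit Types I J S T A B C D : finType.

Definition bij_id I : bijection I I :=
  @Bijection I I id (Bijective (fun _ => erefl) (fun _ => erefl)).

Lemma inj_surj_bij (X Y : Type) (f : X -> Y) :
  injective f -> (forall y, exists x, f x = y) -> bijective f.
Proof.
move=> finj fsurj; exists (fun y => sval (cid (fsurj y))) => [x|y].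
  by apply: finj; case: cid.
by case: cid.
Qed.

Lemma decomp_intro I S T (f : S -> I) (g : T -> I) :
  injective f -> injective g -> (forall s t, f s <> g t) ->
  (forall i, (exists s, f s = i) \/ (exists t, g t = i)) ->
  bijective (case_sum f g).
Proof.
move=> finj ginj fg cov; apply: inj_surj_bij.
  move=> [x|x] [y|y] /= e; first by rewrite (finj _ _ e).
  - by case: (fg x y).
  - by case: (fg y x).
  - by rewrite (ginj _ _ e).
by move=> i; case: (cov i) => -[u <-]; [exists (inl u)|exists (inr u)].
Qed.

Section Elim.
Variables (I S T : finType) (d : decomp I S T).

Lemma decomp_cover i : (exists s, dl d s = i) \/ (exists t, dr d t = i).
Proof.
have [g _ Kg] := decomp_bij d; have := Kg i.
by case: (g i) => u /= <-; [left|right]; exists u.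
Qed.

Lemma dl_inj : injective (dl d).
Proof.
move=> x y xy.
by case: (bij_inj (decomp_bij d) (xy : case_sum _ _ (inl x) = case_sum _ _ (inl y))).
Qed.

Lemma dr_inj : injective (dr d).
Proof.
move=> x y xy.
by case: (bij_inj (decomp_bij d) (xy : case_sum _ _ (inr x) = case_sum _ _ (inr y))).
Qed.

Lemma dl_dr s t : dl d s <> dr d t.
Proof.
move=> st.
by have := bij_inj (decomp_bij d) (st : case_sum _ _ (inl s) = case_sum _ _ (inr t)).
Qed.

Lemma decomp_card : #|I| = (#|S| + #|T|)%N.
Proof. by rewrite -(bij_eq_card (decomp_bij d)) card_sum. Qed.

End Elim.

Lemma decomp_push_subproof I J S T (s : bijection I J) (d : decomp I S T) :
  bijective (case_sum (s \o dl d) (s \o dr d)).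
Proof.
have sinj := bij_inj (bij_prf s).
apply: decomp_intro => [x y /sinj/dl_inj|x y /sinj/dr_inj|x y /sinj/dl_dr|j] //=.
have [s' _ s'K] := bij_prf s.
by case: (decomp_cover d (s' j)) => -[u e]; [left|right]; exists u; rewrite e.
Qed.
Definition decomp_push I J S T (s : bijection I J) (d : decomp I S T) : decomp J S T :=
  Decomp (decomp_push_subproof s d).

Lemma decomp_sum_subproof S T : bijective (case_sum (@inl S T) (@inr S T)).
Proof. by exists id => -[]. Qed.
Definition decomp_sum S T : decomp (S + T)%type S T :=
  Decomp (decomp_sum_subproof S T).

Lemma decomp_set_subproof I (A : {set I}) : bijective
  (case_sum (val : subset_type A -> I) (val : subset_type (~: A) -> I)).
Proof.
apply: decomp_intro => [||[x xA] [y yA] /= xy|i]; try exact: val_inj.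
  by move: yA; rewrite -xy inE xA.
have [iA|iA] := boolP (i \in A); [left; by exists (Sub i iA)|right].
have iA' : i \in ~: A by rewrite inE.
by exists (Sub i iA').
Qed.
Definition decomp_set I (A : {set I}) :
    decomp I (subset_type A) (subset_type (~: A)) :=
  Decomp (decomp_set_subproof A).

Lemma decomp_cross_subproof I S T A B C D (d : decomp I S T)
    (dS : decomp S A B) (dT : decomp T C D) :
  bijective (case_sum (case_sum (dl d \o dl dS) (dr d \o dl dT))
                      (case_sum (dl d \o dr dS) (dr d \o dr dT))).
Proof.
apply: decomp_intro.
- move=> [x|x] [y|y] /=; try (by move/dl_dr); try (by move/esym/dl_dr).
    by move/dl_inj/dl_inj->.
  by move/dr_inj/dl_inj->.
- move=> [x|x] [y|y] /=; try (by move/dl_dr); try (by move/esym/dl_dr).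
    by move/dl_inj/dr_inj->.
  by move/dr_inj/dr_inj->.
- move=> [x|x] [y|y] /=; try (by move/dl_dr); try (by move/esym/dl_dr).
    by move/dl_inj/dl_dr.
  by move/dr_inj/dl_dr.
move=> i; case: (decomp_cover d i) => -[u <-].
  by case: (decomp_cover dS u) => -[v <-]; [left|right]; exists (inl v).
by case: (decomp_cover dT u) => -[v <-]; [left|right]; exists (inr v).
Qed.
(** The recombination I = (A ⊔ C) ⊔ (B ⊔ D) of a refinement of S ⊔ T. Sum types serve as the new
    parts, so that the grid equations hold by computation. *)
Definition decomp_cross I S T A B C D (d : decomp I S T)
    (dS : decomp S A B) (dT : decomp T C D) : decomp I (A + C)%type (B + D)%type :=
  Decomp (decomp_cross_subproof d dS dT).

Lemma decomp_cross_grid I S T A B C D (d : decomp I S T)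
    (dS : decomp S A B) (dT : decomp T C D) :
  decomp_grid d (decomp_cross d dS dT) dS dT (decomp_sum A C) (decomp_sum B D).
Proof. by split. Qed.

(** The (co)associativity axioms take a compatible quadruple of decompositions; this supplies the
    missing member by gluing the embeddings of S and T into I along B = S ⊔ T. *)
Lemma decomp_assoc_exists I A B R S T
    (d1 : decomp I A T) (d2 : decomp A R S) (e2 : decomp B S T) :
  exists e1 : decomp I R B, decomp_assoc d1 d2 e1 e2.
Proof.
have [g gK Kg] := decomp_bij e2.
pose f (b : B) : I := match g b with inl s => dl d1 (dr d2 s) | inr t => dr d1 t end.
have fl s : f (dl e2 s) = dl d1 (dr d2 s) by rewrite /f (gK (inl s)).
have fr t : f (dr e2 t) = dr d1 t by rewrite /f (gK (inr t)).
have bij : bijective (case_sum (dl d1 \o dl d2) f).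
  apply: decomp_intro.
  - by move=> x y /dl_inj/dl_inj.
  - move=> x y; case: (decomp_cover e2 x) => -[u <-]; case: (decomp_cover e2 y) => -[v <-];
      rewrite ?(fl, fr); try (by move/dl_dr); try (by move/esym/dl_dr).
      by move/dl_inj/dr_inj->.
    by move/dr_inj->.
  - move=> x y; case: (decomp_cover e2 y) => -[v <-]; rewrite ?(fl, fr) /=.
      by move/dl_inj/dl_dr.
    by move/dl_dr.
  - move=> i; case: (decomp_cover d1 i) => -[u <-]; last by right; exists (dr e2 u).
    case: (decomp_cover d2 u) => -[v <-]; first by left; exists v.
    by right; exists (dl e2 v).
by exists (Decomp bij); split=> // x; rewrite /= (fl, fr).
Qed.

Section Image.
Variables (I S T : finType) (d : decomp I S T).

Definition decomp_image : {set I} := [set dl d s | s in S].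

Lemma dl_image s : dl d s \in decomp_image.
Proof. exact: imset_f. Qed.
Lemma dr_image t : dr d t \in ~: decomp_image.
Proof. by rewrite inE; apply/imsetP => -[s _ /esym/dl_dr]. Qed.

Lemma dl_to_image_bij :
  bijective (fun s => exist _ (dl d s) (dl_image s) : subset_type decomp_image).
Proof.
apply: inj_surj_bij => [x y /(congr1 val)/= /dl_inj //|[i iA]].
by have [s _ e] := imsetP iA; exists s; apply: val_inj.
Qed.
Lemma dr_to_image_bij :
  bijective (fun t => exist _ (dr d t) (dr_image t) : subset_type (~: decomp_image)).
Proof.
apply: inj_surj_bij => [x y /(congr1 val)/= /dr_inj //|[i iA]].
have [[s e]|[t e]] := decomp_cover d i; last by exists t; apply: val_inj.
by case/negP: (etrans (esym (in_setC _ _)) iA); rewrite -e dl_image.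
Qed.

Definition dl_to_image : bijection S (subset_type decomp_image) :=
  Defs.Bijection dl_to_image_bij.
Definition dr_to_image : bijection T (subset_type (~: decomp_image)) :=
  Defs.Bijection dr_to_image_bij.

(** Every decomposition is isomorphic, over the identity of I, to a subset and its complement;
    naturality then makes a convolution term depend only on that subset. *)
Lemma decomp_map_image :
  decomp_map d (decomp_set decomp_image) id dl_to_image dr_to_image.
Proof. by split. Qed.

End Image.

Lemma decomp_image_set I (A : {set I}) : decomp_image (decomp_set A) = A.
Proof.
apply/setP => i; apply/imsetP/idP => [[[j jA] _ ->] //|iA].
by exists (Sub i iA).
Qed.

End Decompositions.

Local Opaque tensor tens tlift tensmap tens_swap tens_assoc tens_mid
  tens_unassoc tens_rebracket.

(** * Convolution *)

Section Convolution.
Variables (k : fieldType) (h : bimonoid k).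

Definition conv_term (I S T : finType) (d : decomp I S T)
    (f : h S -> h S) (g : h T -> h T) (x : h I) : h I :=
  \mu[h]_d (tensmap f g (\Delta[h]_d x)).

HB.instance Definition _ (I S T : finType) (d : decomp I S T)
    (f : {linear h S -> h S}) (g : {linear h T -> h T}) :=
  GRing.Linear.copy (conv_term d f g) (\mu[h]_d \o tensmap f g \o \Delta[h]_d).

Lemma conv_term_map (I S T I' S' T' : finType)
    (d : decomp I S T) (d' : decomp I' S' T')
    (s : bijection I I') (a : bijection S S') (b : bijection T T')
    (f : {linear h S -> h S}) (g : {linear h T -> h T})
    (f' : {linear h S' -> h S'}) (g' : {linear h T' -> h T'}) (x : h I) :
  decomp_map d d' s a b ->
  (forall y, sp_map h a (f y) = f' (sp_map h a y)) ->
  (forall y, sp_map h b (g y) = g' (sp_map h b y)) ->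
  sp_map h s (conv_term d f g x) = conv_term d' f' g' (sp_map h s x).
Proof.
move=> dd' af bg; rewrite /conv_term.
apply: etrans (mu_natural _ dd' _) _; apply: congr1.
apply: etrans (tensmap_comp _ _ _ _ _) _.
apply: (etrans _ (congr1 (tensmap f' g') (esym (Delta_natural _ dd' _)))).
apply: (etrans _ (esym (tensmap_comp _ _ _ _ _))).
exact: tensmap_ext.
Qed.

Lemma conv_term_image (I S T : finType) (d : decomp I S T) (f g : sp_morph h h) x :
  conv_term d (f S) (g T) x =
  conv_term (decomp_set (decomp_image d)) (f _) (g _) x.
Proof.
have id1 : sp_map h (bij_id I) =1 id by exact: sp_map_id.
rewrite -[LHS]id1 -[x in RHS]id1.
apply: (@conv_term_map _ _ _ _ _ _ _ _ (bij_id I) _ _ (f S) (g T) (f _) (g _) x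
  (decomp_map_image d)) => y; exact: esym (sp_morph_natural _ _ _).
Qed.

Definition id_morph : sp_morph h h :=
  @SpMorph k h h (fun I => idfun) (fun _ _ _ _ => erefl).

Section Conv.
Variables (P : pred nat) (f : sp_morph h h).

(** One definition for two left factors: [predT] gives id * f, and the restriction to nonempty A
    gives, for connected h, (id - iota o epsilon) * f. *)
Definition conv (I : finType) (x : h I) : h I :=
  \sum_(A : {set I} | P #|A|) conv_term (decomp_set A) idfun (f _) x.

Lemma conv_linear (I : finType) : linear (@conv I).
Proof.
move=> c x y; rewrite /conv scaler_sumr -big_split /=.
by apply: eq_bigr => A _; rewrite linearP.
Qed.
HB.instance Definition _ (I : finType) :=
  GRing.isLinear.Build k (h I) (h I) *:%R (@conv I) (@conv_linear I).

(** By [conv_term_image] a term is determined by the image of its left part, so any family meeting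
    each subset exactly once may replace the canonical one. The condition on sizes carries over
    because [dl] is injective. *)
Lemma conv_reindex (I J : finType) (S T : J -> finType)
    (d : forall j, decomp I (S j) (T j)) (x : h I) :
  bijective (fun j => decomp_image (d j)) ->
  conv x = \sum_(j | P #|S j|) conv_term (d j) idfun (f (T j)) x.
Proof.
move=> dbij; rewrite /conv (reindex _ (onW_bij _ dbij)) /=.
apply: eq_big => [j|j _]; first by rewrite card_imset //; exact: dl_inj.
exact: esym (conv_term_image _ id_morph _ _).
Qed.

Lemma conv_natural (I J : finType) (s : bijection I J) (x : h I) :
  conv (sp_map h s x) = sp_map h s (conv x).
Proof.
(* Decompositions of J are taken as push-forwards along [s] of those of I, so both sums run over the
   subsets of I. *)
rewrite (@conv_reindex _ _ _ _ (fun A : {set I} => decomp_push s (decomp_set A))).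
  rewrite linear_sum; apply: eq_big => [A|A _]; first by rewrite card_sig.
  apply/esym/(@conv_term_map _ _ _ _ _ _ _ _ s (bij_id _) (bij_id _)) => // y.
  by rewrite sp_morph_natural.
have imE (A : {set I}) : decomp_image (decomp_push s (decomp_set A)) = s @: A.
  rewrite -[A in RHS]decomp_image_set.
  by apply/setP => j; rewrite /decomp_image -imset_comp.
have [s' sK s'K] := bij_prf s.
apply: (eq_bij _ (fun A => esym (imE A))).
exists (fun A : {set J} => s' @: A) => A; rewrite -imset_comp.
  by rewrite (eq_imset _ sK) imset_id.
by rewrite (eq_imset _ s'K) imset_id.
Qed.

Definition conv_morph : sp_morph h h :=
  @SpMorph k h h (fun I => @conv I) conv_natural.

End Conv.
End Convolution.

(** * Interchange laws and (co)multiplicativity of convolution powers *)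

Section Grid.
Variables (k : fieldType) (h : bimonoid k).
Implicit Types I S T A B C D W Z : finType.

(** Mirror image of [decomp_assoc_exists], obtained by reversing all decompositions. *)
Lemma decomp_assoc_exists_l I A B R S T
    (e1 : decomp I R B) (e2 : decomp B S T) (d2 : decomp A R S) :
  exists d1 : decomp I A T, decomp_assoc d1 d2 e1 e2.
Proof.
have [d [dl1 dl2 dl3]] :=
  decomp_assoc_exists (decomp_sym e1) (decomp_sym e2) (decomp_sym d2).
by exists (decomp_sym d); split=> x; [exact: esym (dl3 x)|exact: esym (dl2 x)|exact: esym (dl1 x)].
Qed.

Section Rebracket.
Variables (I S T A B C D W Z : finType).
Variables (e : decomp I S T) (eS : decomp S A C) (eT : decomp T B D).
Variables (f : decomp I A Z) (z : decomp Z W D) (w : decomp W C B).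
Hypothesis eA : dl e \o dl eS =1 dl f.
Hypothesis eC : dl e \o dr eS =1 dr f \o dl z \o dl w.
Hypothesis eB : dr e \o dl eT =1 dr f \o dl z \o dr w.
Hypothesis eD : dr e \o dr eT =1 dr f \o dr z.

(** Passing from (A ⊔ C) ⊔ (B ⊔ D) to A ⊔ ((C ⊔ B) ⊔ D) takes two reassociations, with A ⊔ (C ⊔ T)
    in between. The target form isolates the two middle blocks in W. *)
Lemma rebracket_assoc : exists g : decomp Z C T,
  decomp_assoc e eS f g /\ decomp_assoc z w g eT.
Proof.
have [g zg] := decomp_assoc_exists z w eT; exists g; split=> //.
case: zg => g1 g2 g3; split=> // x.
  exact: etrans (eC x) (congr1 (dr f) (g1 x)).
case: (decomp_cover eT x) => -[y <-].
  exact: etrans (eB y) (congr1 (dr f) (g2 y)).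
exact: etrans (eD y) (congr1 (dr f) (g3 y)).
Qed.

Lemma mu_rebracket a b c x :
  \mu[h]_e (tens (\mu[h]_eS (tens a c)) (\mu[h]_eT (tens b x))) =
  \mu[h]_f (tens a (\mu[h]_z (tens (\mu[h]_w (tens c b)) x))).
Proof.
have [g [fg zg]] := rebracket_assoc.
have muAE I' A' B' R' S' T' (d1 : decomp I' A' T') (d2 : decomp A' R' S')
    (e1 : decomp I' R' B') (e2 : decomp B' S' T') r s t : decomp_assoc d1 d2 e1 e2 ->
    \mu[h]_d1 (tens (\mu[h]_d2 (tens r s)) t) =
    \mu[h]_e1 (tens r (\mu[h]_e2 (tens s t))).
  move=> ass; apply: etrans (etrans (muA (bim_mon h) ass (tens (tens r s) t)) _).
    by apply: congr1; exact: esym (tensmapE _ idfun _ _).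
  apply: congr1; apply: etrans (congr1 _ (tens_assocE _ _ _)) _.
  exact: (tensmapE idfun).
apply: etrans (muAE _ _ _ _ _ _ _ _ _ _ _ _ _ fg) _.
apply: congr1; apply: (congr1 (tens a)).
exact: esym (muAE _ _ _ _ _ _ _ _ _ _ _ _ _ zg).
Qed.

Lemma Delta_rebracket x :
  tensmap (\Delta[h]_eS) (\Delta[h]_eT) (\Delta[h]_e x) =
  tens_rebracket (tensmap idfun (tensmap (\Delta[h]_w) idfun \o \Delta[h]_z)
    (\Delta[h]_f x)).
Proof.
have [g [fg zg]] := rebracket_assoc.
transitivity (tensmap idfun (\Delta[h]_eT) (tensmap (\Delta[h]_eS) idfun (\Delta[h]_e x))).
  exact: esym (tensmap_comp (\Delta[h]_eS) idfun idfun (\Delta[h]_eT) _).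
have -> : tensmap (\Delta[h]_eS) idfun (\Delta[h]_e x) =
    tens_unassoc (tensmap idfun (\Delta[h]_g) (\Delta[h]_f x)).
  exact: etrans (esym (tens_assocK _)) (congr1 _ (DeltaA _ fg _)).
(* The identity on the left factor is split as [tensmap idfun idfun], to fit the naturality of
   [tens_unassoc]. *)
apply: etrans (tensmap_ext (fun y => esym (tensmap_id y)) (fun=> erefl) _) _.
apply: etrans (esym (tens_unassoc_natural idfun idfun _ _)) _.
apply: (congr1 (@tens_unassoc _ _ _ _)).
apply: etrans (tensmap_comp _ _ _ _ _) _.
apply: (etrans _ (esym (tensmap_comp _ _ _ _ _))).
by apply: tensmap_ext => // y; exact: esym (DeltaA _ zg _).
Qed.

End Rebracket.

Section Interchange.
Variables (I S T S' T' A B C D : finType).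
Variables (d : decomp I S T) (e : decomp I S' T').
Variables (dS : decomp S A B) (dT : decomp T C D).
Variables (eS : decomp S' A C) (eT : decomp T' B D).
Hypothesis grid : decomp_grid d e dS dT eS eT.

Lemma rebracket_grid : exists (f : decomp I A (B + T)%type)
    (z : decomp (B + T)%type (B + C)%type D),
  [/\ dl d \o dl dS =1 dl f,
      dl d \o dr dS =1 dr f \o dl z \o dl (decomp_sum B C),
      dr d \o dl dT =1 dr f \o dl z \o dr (decomp_sum B C) &
      dr d \o dr dT =1 dr f \o dr z].
Proof.
have [f [f1 f2 f3]] := decomp_assoc_exists d dS (decomp_sum B T).
have [z [z1 z2 z3]] := decomp_assoc_exists_l (decomp_sum B T) dT (decomp_sum B C).
exists f, z; split=> // x.
- exact: etrans (f2 x) (congr1 (dr f) (esym (z1 x))).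
- exact: etrans (f3 (dl dT x)) (congr1 (dr f) (esym (z2 x))).
- exact: etrans (f3 (dr dT x)) (congr1 (dr f) (esym (z3 x))).
Qed.

(** Both sides rebracket through the same [f] and [z] to a product A, (middle), D, and differ only
    in the order of B and C in the middle, where commutativity applies. Categorically: the product
    of a commutative monoid is itself a morphism of monoids. *)
Lemma mu_interchange : commutative_bimonoid h -> forall t,
  \mu[h]_e (tensmap (\mu[h]_eS) (\mu[h]_eT) (tens_mid t)) =
  \mu[h]_d (tensmap (\mu[h]_dS) (\mu[h]_dT) t).
Proof.
move=> hC; have [f [z [dA dB dC dD]]] := rebracket_grid.
have [gA gB gC gD] := grid.
apply: tens_hom_ext4 => [y u v|y u v|a b c x].
- apply: (etrans _ (linearP (\mu[h]_e) _ _ _)); apply: (congr1 (\mu[h]_e)).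
  apply: (etrans _ (tensmap_linear (\mu[h]_eS) (\mu[h]_eT) _ _ _)).
  apply: (congr1 (tensmap _ _)); exact: tens_mid_linear.
- apply: (etrans _ (linearP (\mu[h]_d) _ _ _)); apply: (congr1 (\mu[h]_d)).
  exact: tensmap_linear.
transitivity (\mu[h]_e (tens (\mu[h]_eS (tens a c)) (\mu[h]_eT (tens b x)))).
  apply: (congr1 (\mu[h]_e)).
  exact: etrans (congr1 _ (tens_midE _ _ _ _)) (tensmapE _ _ _ _).
transitivity (\mu[h]_d (tens (\mu[h]_dS (tens a b)) (\mu[h]_dT (tens c x)))); last first.
  by apply: (congr1 (\mu[h]_d)); exact: esym (tensmapE _ _ _ _).
apply: etrans (mu_rebracket (f := f) (z := z) (w := decomp_sym (decomp_sum B C)) _ _ _ _ _ _ _ _) _.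
- by move=> y; exact: etrans (esym (gA y)) (dA y).
- by move=> y; exact: etrans (esym (gC y)) (dC y).
- by move=> y; exact: etrans (esym (gB y)) (dB y).
- by move=> y; exact: etrans (esym (gD y)) (dD y).
apply: (etrans _ (esym (mu_rebracket dA dB dC dD _ _ _ _))).
apply: congr1; apply: (congr1 (tens a)); apply: congr1; apply: (congr1 (tens^~ x)).
by apply: (etrans _ (esym (hC _ _ _ _ _))); apply: congr1; exact: esym (tens_swapE _ _).
Qed.

Lemma Delta_interchange : cocommutative_bimonoid h -> forall x,
  tens_mid (tensmap (\Delta[h]_eS) (\Delta[h]_eT) (\Delta[h]_e x)) =
  tensmap (\Delta[h]_dS) (\Delta[h]_dT) (\Delta[h]_d x).
Proof.
move=> hC x; have [f [z [dA dB dC dD]]] := rebracket_grid.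
have [gA gB gC gD] := grid.
have eE := Delta_rebracket (w := decomp_sym (decomp_sum B C))
  (fun y => etrans (esym (gA y)) (dA y)) (fun y => etrans (esym (gC y)) (dC y))
  (fun y => etrans (esym (gB y)) (dB y)) (fun y => etrans (esym (gD y)) (dD y)) x.
apply: etrans (congr1 (@tens_mid _ _ _ _ _) eE) _.
apply: (etrans _ (esym (Delta_rebracket dA dB dC dD x))).
apply: (etrans _ (tens_mid_rebracket _)).
apply: (congr1 (@tens_mid _ _ _ _ _)); apply: (congr1 (@tens_rebracket _ _ _ _ _)).
apply: (etrans _ (esym (tensmap_comp _ _ _ _ _))).
apply: tensmap_ext => // y.
apply: (etrans _ (esym (tensmap_comp _ _ _ _ _))).
by apply: tensmap_ext => // u; exact: hC.
Qed.

End Interchange.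
End Grid.

Section Multiplicative.
Variables (k : fieldType) (h : bimonoid k).

Definition mu_compatible (f : sp_morph h h) : Prop :=
  forall (I S T : finType) (d : decomp I S T) (t : tensor (h S) (h T)),
    f I (\mu[h]_d t) = \mu[h]_d (tensmap (f S) (f T) t).

Definition Delta_compatible (f : sp_morph h h) : Prop :=
  forall (I S T : finType) (d : decomp I S T) (x : h I),
    \Delta[h]_d (f I x) = tensmap (f S) (f T) (\Delta[h]_d x).

Definition cross_set (I S T : finType) (d : decomp I S T)
    (p : {set S} * {set T}) :=
  decomp_cross d (decomp_set p.1) (decomp_set p.2).

(** The left part of the cross decomposition for (B, C) is the union of the images of B and C, and
    the two are recovered as its preimages in S and T. *)
Lemma cross_set_bij (I S T : finType) (d : decomp I S T) :
  bijective (fun p => decomp_image (cross_set d p)).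
Proof.
have imE p i : (i \in decomp_image (cross_set d p)) =
    (i \in [set dl d s | s in p.1]) || (i \in [set dr d t | t in p.2]).
  apply/imsetP/orP => [[[[s sA]|[t tA]] _ ->]|[/imsetP[s sA ->]|/imsetP[t tA ->]]] /=.
  - by left; exact: imset_f.
  - by right; exact: imset_f.
  - by exists (inl (Sub s sA)).
  - by exists (inr (Sub t tA)).
have imL p s : (dl d s \in decomp_image (cross_set d p)) = (s \in p.1).
  rewrite imE mem_imset; last exact: dl_inj.
  by case: imsetP => [[t _ /dl_dr]|]; rewrite ?orbF.
have imR p t : (dr d t \in decomp_image (cross_set d p)) = (t \in p.2).
  rewrite imE (mem_imset _ _ (@dr_inj _ _ _ d)).
  by case: imsetP => [[s _ /esym/dl_dr]|]; rewrite ?orbF.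
apply: inj_surj_bij => [[A B] [A' B'] /setP e|A].
  congr pair; apply/setP => x; first by have := e (dl d x); rewrite !imL.
  by have := e (dr d x); rewrite !imR.
exists ([set s | dl d s \in A], [set t | dr d t \in A]); apply/setP => i.
by case: (decomp_cover d i) => -[u <-]; rewrite (imL, imR) inE.
Qed.

Lemma tensmap_conv (S T : finType) (f : sp_morph h h) (t : tensor (h S) (h T)) :
  tensmap (conv predT f (I := S)) (conv predT f (I := T)) t =
  \sum_(p : {set S} * {set T})
    tensmap (conv_term (decomp_set p.1) idfun (f _))
            (conv_term (decomp_set p.2) idfun (f _)) t.
Proof.
have convE R (x : h R) : conv predT f x =
    \sum_(A : {set R} | true) 1 *: conv_term (decomp_set A) idfun (f _) x.
  by apply: eq_bigr => A _; rewrite scale1r.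
apply: etrans (tensmap_ext (convE S) (convE T) t) _.
apply: etrans (tensmap_suml _ _ _ _ _ _) _.
rewrite -(pair_big predT predT (fun (A : {set S}) (B : {set T}) =>
  tensmap (conv_term (decomp_set A) idfun (f _))
          (conv_term (decomp_set B) idfun (f _)) t)) /=.
apply: eq_bigr => A _; rewrite scale1r.
apply: etrans (tensmap_sumr _ _ _ _ _ _) _.
by apply: eq_bigr => B _; rewrite scale1r.
Qed.

(** After re-indexing by pairs of subsets, [bim_Delta_mu] carries the coproduct past the product in
    each term, the hypothesis on [f] does the same for [f], and [mu_interchange] regroups the
    products. *)
Lemma conv_mu_compatible (f : sp_morph h h) : commutative_bimonoid h ->
  mu_compatible f -> mu_compatible (conv_morph predT f).
Proof.
move=> hC fM I S T d t.
apply: etrans (conv_reindex predT f (\mu[h]_d t) (cross_set_bij d)) _.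
apply: (etrans _ (congr1 (\mu[h]_d) (esym (tensmap_conv f t)))).
rewrite linear_sum; apply: eq_bigr => -[B C] _ /=.
set dB := decomp_set B; set dC := decomp_set C.
have grid := decomp_cross_grid d dB dC.
rewrite {1}/conv_term.
transitivity (\mu[h]_(decomp_cross d dB dC)
  (tensmap (\mu[h]_(decomp_sum _ _)) (\mu[h]_(decomp_sum _ _))
  (tens_mid (tensmap (tensmap idfun (f _)) (tensmap idfun (f _))
    (tensmap (\Delta[h]_dB) (\Delta[h]_dC) t))))).
  apply: congr1.
  apply: etrans (congr1 (tensmap idfun (f _)) (bim_Delta_mu grid t)) _.
  apply: etrans (tensmap_comp _ _ _ _ _) _.
  apply: (etrans _ (congr1 (tensmap _ _) (esym (tens_mid_natural _ _ _ _ _)))).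
  apply: (etrans _ (esym (tensmap_comp _ _ _ _ _))).
  apply: tensmap_ext => y /=; last exact: fM.
  by apply: congr1; exact: esym (tensmap_id _).
apply: etrans (mu_interchange grid hC _) _.
apply: congr1; apply: etrans (congr1 _ (tensmap_comp _ _ _ _ _)) _.
exact: etrans (tensmap_comp _ _ _ _ _) _.
Qed.

Lemma conv_Delta_compatible (f : sp_morph h h) : cocommutative_bimonoid h ->
  Delta_compatible f -> Delta_compatible (conv_morph predT f).
Proof.
move=> hC fM I S T d x.
rewrite [conv_morph _ _ _ _](conv_reindex predT f x (cross_set_bij d)).
apply: (etrans _ (esym (tensmap_conv f _))).
rewrite linear_sum; apply: eq_bigr => -[B C] _ /=.
set dB := decomp_set B; set dC := decomp_set C.
have grid := decomp_cross_grid d dB dC.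
have [g1 g2 g3 g4] := grid.
(* The same grid with rows and columns exchanged: here the product is taken along the cross
   decomposition and the coproduct along [d]. *)
have grid' : decomp_grid (decomp_cross d dB dC) d (decomp_sum _ _) (decomp_sum _ _) dB dC.
  by split.
apply: etrans (bim_Delta_mu grid' _) _.
transitivity (tensmap (\mu[h]_dB) (\mu[h]_dC) (tensmap (tensmap idfun (f _)) (tensmap idfun (f _))
  (tens_mid (tensmap (\Delta[h]_(decomp_sum _ _)) (\Delta[h]_(decomp_sum _ _))
    (\Delta[h]_(decomp_cross d dB dC) x))))).
  apply: (congr1 (tensmap _ _)).
  apply: (etrans _ (tens_mid_natural _ _ _ _ _)).
  apply: (congr1 (@tens_mid _ _ _ _ _)).
  apply: etrans (tensmap_comp _ _ _ _ _) _.
  apply: (etrans _ (esym (tensmap_comp _ _ _ _ _))).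
  apply: tensmap_ext => y /=; last exact: fM.
  by exact: esym (tensmap_id _).
rewrite [X in tensmap _ _ (tensmap _ _ X)](Delta_interchange grid hC x).
apply: etrans (congr1 _ (tensmap_comp _ _ _ _ _)) _.
exact: etrans (tensmap_comp _ _ _ _ _) _.
Qed.

End Multiplicative.

(** * Extraction of the linear coefficient *)

Section Coefficients.
Variables (k : fieldType) (k_char0 : [pchar k] =i pred0).

Lemma natr_inj : injective (fun n : nat => n%:R : k).
Proof.
suff le m n : (m <= n)%N -> m%:R = n%:R :> k -> m = n.
  move=> m n e; case/orP: (leq_total m n) => mn; first exact: le mn e.
  exact: esym (le _ _ mn (esym e)).
move=> mn /esym/eqP.
rewrite -subr_eq0 -natrB // ((pcharf0P k).1 k_char0) subn_eq0 => nm.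
by apply/eqP; rewrite eqn_leq mn.
Qed.

(** The binomial polynomial X(X - 1)...(X - i + 1)/i!. *)
Fixpoint binpoly (i : nat) : {poly k} :=
  if i is j.+1 then i%:R^-1 *: (binpoly j * ('X - j%:R%:P)) else 1.

Lemma binpolyE i n : (binpoly i).[n%:R] = 'C(n, i)%:R.
Proof.
elim: i => [|i IH]; first by rewrite hornerC bin0.
have i0 : i.+1%:R != 0 :> k by rewrite ((pcharf0P k).1 k_char0).
rewrite /= hornerZ hornerM IH hornerXsubC.
apply: (mulfI i0); rewrite mulVKf // -natrM mul_bin_left natrM mulrC.
case: (leqP i n) => ni; first by rewrite natrB.
by rewrite bin_small ?mulr0.
Qed.

Lemma coef0_binpoly i : (binpoly i.+1)`_0 = 0.
Proof.
elim: i => [|i IH]; first by rewrite /= mul1r subr0 coefZ coefX mulr0.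
by rewrite [binpoly _]/= coefZ coef0M IH mul0r mulr0.
Qed.

(** Divide X(X - 1)...(X - i)/(i + 1)! by X and set X = 0: the result is (-1)^i i!/(i + 1)!. These
    are the coefficients of log(1 + t). *)
Lemma coef1_binpoly i : (binpoly i.+1)`_1 = (-1) ^+ i / i.+1%:R.
Proof.
elim: i => [|i IH]; first by rewrite /= mul1r subr0 coefZ coefX mulr1 mul1r.
have -> : binpoly i.+2 = i.+2%:R^-1 *: (binpoly i.+1 * ('X - i.+1%:R%:P)) by [].
rewrite coefZ mulrBr coefB coefMX coefMC /= coef0_binpoly IH sub0r.
have i0 : i.+1%:R != 0 :> k by rewrite ((pcharf0P k).1 k_char0).
by rewrite divfK // exprS mulN1r mulrC.
Qed.

(** The nodes 0, ..., N - 1 are distinct in k, so the Vandermonde matrix is invertible; [c] is the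
    solution of sum_n c_n n^i = [i = 1] for i < N. *)
Lemma coef1_interpolation N : exists c : 'I_N -> k, forall p : {poly k},
  (size p <= N)%N -> p`_1 = \sum_(n < N) c n * p.[n%:R].
Proof.
pose V := Vandermonde N (\row_(j < N) (j%:R : k)).
have Vu : V \in unitmx.
  rewrite unitmxE det_Vandermonde unitfE; apply/prodf_neq0 => i _.
  apply/prodf_neq0 => j ij; rewrite !mxE subr_eq0; apply/eqP => /natr_inj e.
  by rewrite e ltnn in ij.
pose e1 : 'cV[k]_N := \col_i (i == 1 :> nat)%:R.
pose c := invmx V *m e1.
have Vc : V *m c = e1 by rewrite mulKVmx.
exists (fun n => c n 0) => p pN.
transitivity (\sum_(i < N) p`_i * e1 i 0).
  case: (ltnP 1 N) => N1.
    rewrite (bigD1 (Ordinal N1)) //= mxE eqxx mulr1 big1 ?addr0 // => i i1.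
    have -> : e1 i 0 = 0 by rewrite mxE -(inj_eq val_inj) /= in i1 *; rewrite (negPf i1).
    by rewrite mulr0.
  (* For N at most 1 the polynomial is constant and [e1] is the zero column, so both sides
     vanish. *)
  rewrite nth_default; last exact: leq_trans N1.
  rewrite big1 // => i _; rewrite mxE.
  have -> : (i == 1 :> nat) = false by apply/eqP => i1; have := ltn_ord i; rewrite i1 ltnNge N1.
  by rewrite mulr0.
rewrite -Vc.
under eq_bigr do rewrite mxE mulr_sumr.
rewrite exchange_big; apply: eq_bigr => n _ /=.
rewrite (horner_coef_wide _ pN) mulr_sumr; apply: eq_bigr => i _.
by rewrite !mxE mulrA mulrC.
Qed.

(** The vectors may be dependent and the two families unrelated, so polynomials cannot be compared
    one by one; instead a single interpolation functional, valid for all degrees involved, is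
    applied to both sides. *)
Lemma coef1_ext (V : lmodType k) (J1 J2 : finType)
    (p : J1 -> {poly k}) (q : J2 -> {poly k}) (v : J1 -> V) (w : J2 -> V) :
  (forall n : nat, \sum_j (p j).[n%:R] *: v j = \sum_j (q j).[n%:R] *: w j) ->
  \sum_j (p j)`_1 *: v j = \sum_j (q j)`_1 *: w j.
Proof.
move=> pq.
pose N := maxn (\max_j size (p j)) (\max_j size (q j)).
have [c cE] := coef1_interpolation N.
have coefE (J : finType) (r : J -> {poly k}) (u : J -> V) :
    (forall j, size (r j) <= N)%N ->
    \sum_j (r j)`_1 *: u j = \sum_(n < N) c n *: \sum_j (r j).[n%:R] *: u j.
  move=> rN; under [RHS]eq_bigr do rewrite scaler_sumr.
  rewrite exchange_big; apply: eq_bigr => j _ /=; rewrite cE // scaler_suml.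
  by apply: eq_bigr => n _; rewrite scalerA.
rewrite !coefE => [|j|j]; first by apply: eq_bigr => n _; rewrite pq.
  by apply: leq_trans (leq_maxr _ _); exact: (leq_bigmax (F := fun j => size (q j))).
by apply: leq_trans (leq_maxl _ _); exact: (leq_bigmax (F := fun j => size (p j))).
Qed.

End Coefficients.

(** * Convolution powers of the identity *)

Section Powers.
Variables (k : fieldType) (h : bimonoid k) (h_conn : connected_bimonoid h).

(** With 1 = c1 e0 for a spanning vector e0, the axiom epsilon(1) = 1 reads c1 epsilon(e0) = 1, so
    iota o epsilon fixes e0. *)
Lemma connected_counit (e : h void) : e = counit (bim_comon h) e *: sp_one (bim_mon h).
Proof.
have [e0 _ gen] := h_conn; have [c1 e1] := gen (sp_one (bim_mon h)).
have [c ->] := gen e; have := bim_counit_one h.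
rewrite e1 !linearZ /= scalerA => c1e; congr (_ *: _).
have c1e' : c1 * counit (bim_comon h) e0 = 1 := c1e.
rewrite -[LHS]mulr1 -c1e'.
exact: mulrCA.
Qed.

Lemma card0_void_bij (S : finType) : #|S| = 0%N -> inhabited (bijection S void).
Proof.
move=> S0; have no (s : S) : False by have := fintype0 s S0.
have abij : bijective (fun s => match no s return void with end).
  by exists (@of_empty S) => [s|[]]; case: (no s).
by exists; exact: Defs.Bijection abij.
Qed.

(** By naturality the empty part may be taken to be [void]. There connectedness writes every element
    as epsilon(e) 1, and the unit and counit axioms collapse the term. *)
Lemma conv_term_void_l (I S T : finType) (d : decomp I S T) (f : sp_morph h h) x :
  #|S| = 0%N -> conv_term d idfun (f T) x = f I x.
Proof.
move=> S0; have [a] := card0_void_bij S0.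
have no (s : S) : False by have := fintype0 s S0.
have bbij : bijective (dr d).
  apply: inj_surj_bij; first exact: dr_inj.
  by move=> i; case: (decomp_cover d i) => // -[s]; case: (no s).
pose b := Defs.Bijection bbij.
have dab : decomp_map d (decomp_void_l I) (bij_id I) a b by split=> [s|t] //; case: (no s).
have id1 : sp_map h (bij_id I) =1 id by exact: sp_map_id.
rewrite -[LHS]id1 (@conv_term_map _ _ _ _ _ _ _ _ _ _ _ a b _ _ idfun (f I) x dab) //; last first.
  by move=> y; exact: esym (sp_morph_natural _ _ _).
rewrite id1 /conv_term.
transitivity (f I (tlift (fun e y => counit (bim_comon h) e *: y)
    (\Delta[h]_(decomp_void_l I) x))); last first.
  by apply: congr1; exact: Delta1l.
have bil : bilinear_fun (fun (e : h void) (y : h I) => counit (bim_comon h) e *: y).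
  split=> [c e e' y|c e y y']; first by rewrite linearP scalerDl scalerA.
  by rewrite scalerDr !scalerA mulrC.
(* Both sides are now linear in the coproduct of x, which can be generalized to an arbitrary tensor
   and tested on pure ones. *)
move: (\Delta[h]_(decomp_void_l I) x).
apply: tensor_hom_ext => [c u v|c u v|e y].
- apply: (etrans _ (linearP (\mu[h]_(decomp_void_l I)) _ _ _)).
  by apply: congr1; exact: tensmap_linear.
- apply: (etrans _ (linearP (f I) _ _ _)).
  by apply: congr1; exact: tlift_linear.
apply: etrans (congr1 _ (tensmapE _ _ _ _)) _.
apply: (etrans _ (congr1 _ (esym (tliftE bil _ _)))).
apply: (etrans _ (esym (linearZZ (f I) _ _))).
rewrite [e in LHS]connected_counit.
apply: etrans (congr1 _ (tensZl _ _ _)) _.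
apply: etrans (linearZZ (\mu[h]_(_)) _ _) _; apply: congr1; exact: mu1l.
Qed.

Lemma conv_term_void_r (I S T : finType) (d : decomp I S T) (x : h I) :
  #|T| = 0%N -> conv_term (h := h) d idfun idfun x = x.
Proof.
move=> T0; have [b] := card0_void_bij T0.
have no (s : T) : False by have := fintype0 s T0.
have abij : bijective (dl d).
  apply: inj_surj_bij; first exact: dl_inj.
  by move=> i; case: (decomp_cover d i) => // -[s]; case: (no s).
pose a := Defs.Bijection abij.
have dab : decomp_map d (decomp_void_r I) (bij_id I) a b by split=> [s|t] //; case: (no t).
have id1 : sp_map h (bij_id I) =1 id by exact: sp_map_id.
rewrite -[LHS]id1 (@conv_term_map _ _ _ _ _ _ _ _ _ _ _ a b _ _ idfun idfun x dab) //.
rewrite id1 /conv_term.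
transitivity (tlift (fun y e => counit (bim_comon h) e *: y)
    (\Delta[h]_(decomp_void_r I) x)); last exact: Delta1r.
have bil : bilinear_fun (fun (y : h I) (e : h void) => counit (bim_comon h) e *: y).
  split=> [c e e' y|c e y y']; last by rewrite linearP scalerDl scalerA.
  by rewrite scalerDr !scalerA mulrC.
move: (\Delta[h]_(decomp_void_r I) x).
apply: tensor_hom_ext => [c u v|c u v|y e].
- apply: (etrans _ (linearP (\mu[h]_(decomp_void_r I)) _ _ _)).
  by apply: congr1; exact: tensmap_linear.
- exact: tlift_linear.
apply: etrans (congr1 _ (tensmapE _ _ _ _)) _.
apply: (etrans _ (esym (tliftE bil _ _))).
rewrite [e in LHS]connected_counit.
apply: etrans (congr1 _ (tensZr _ _ _)) _.
apply: etrans (linearZZ (\mu[h]_(_)) _ _) _; apply: congr1; exact: mu1r.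
Qed.

Lemma conv_term_sumr (I S T : finType) (d : decomp I S T) (f : h S -> h S)
    (J : finType) (c : J -> k) (g : J -> h T -> h T) (x : h I) :
  conv_term d f (fun y => \sum_j c j *: g j y) x =
  \sum_j c j *: conv_term d f (g j) x.
Proof.
apply: etrans (congr1 _ (tensmap_sumr _ _ _ _ _ _)) _.
by rewrite linear_sum; apply: eq_bigr => j _; rewrite linearZ.
Qed.

(* For connected h this is the unit of the convolution algebra, iota o epsilon. *)
Definition unit_fun (I : finType) (x : h I) : h I := if #|I| == 0%N then x else 0.

Lemma unit_fun_linear (I : finType) : linear (@unit_fun I).
Proof. by move=> c x y; rewrite /unit_fun; case: ifP; rewrite // scaler0 addr0. Qed.
HB.instance Definition _ (I : finType) :=
  GRing.isLinear.Build k (h I) (h I) *:%R (@unit_fun I) (@unit_fun_linear I).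

Lemma unit_fun_natural (I J : finType) (s : bijection I J) (x : h I) :
  unit_fun (sp_map h s x) = sp_map h s (unit_fun x).
Proof.
by rewrite /unit_fun (bij_eq_card (bij_prf s)); case: ifP; rewrite ?linear0.
Qed.

Definition unit_morph : sp_morph h h :=
  @SpMorph k h h (fun I => @unit_fun I) unit_fun_natural.

(* The n-th convolution powers of id and, below, of id - iota o epsilon. *)
Definition adams (n : nat) : sp_morph h h := iter n (conv_morph predT) unit_morph.

Definition pos_power (n : nat) : sp_morph h h :=
  iter n (conv_morph (fun m => 0 < m)%N) unit_morph.

(** I is empty exactly when S and T both are. This makes psi_0 multiplicative and comultiplicative,
    the base case of [adams_mu] and [adams_Delta]. *)
Lemma tensmap_unit (I S T : finType) (d : decomp I S T) (t : tensor (h S) (h T)) :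
  tensmap (@unit_fun S) (@unit_fun T) t = if #|I| == 0%N then t else 0.
Proof.
rewrite (decomp_card d) addn_eq0.
case: eqP => S0 /=.
  case: eqP => T0 /=.
    by apply: etrans (tensmap_ext _ _ _) (tensmap_id _) => y; rewrite /unit_fun (S0, T0).
  apply: etrans (tensmap_ext (fun=> erefl) _ _) (tensmap0r _ _ _) => y.
  by rewrite /unit_fun; case: eqP.
apply: etrans (tensmap_ext _ (fun=> erefl) _) (tensmap0l _ _ _) => y.
by rewrite /unit_fun; case: eqP.
Qed.

Lemma adams_mu n : commutative_bimonoid h -> mu_compatible (adams n).
Proof.
move=> hC; elim: n => [|n IH]; last exact: conv_mu_compatible.
move=> I S T d t; apply: (etrans _ (congr1 _ (esym (tensmap_unit d t)))).
by rewrite /= /unit_fun; case: ifP => //; rewrite linear0.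
Qed.

Lemma adams_Delta n :
  cocommutative_bimonoid h -> Delta_compatible (adams n).
Proof.
move=> hC; elim: n => [|n IH]; last exact: conv_Delta_compatible.
move=> I S T d x; apply: (etrans _ (esym (tensmap_unit d _))).
by rewrite /= /unit_fun; case: ifP => //; rewrite linear0.
Qed.

(** Each factor uses up a nonempty block, so the complement left to the remaining factors is
    strictly smaller. *)
Lemma pos_power_small n (I : finType) (x : h I) : (#|I| < n)%N -> pos_power n I x = 0.
Proof.
elim: n I x => // n IH I x; rewrite ltnS => In.
rewrite /= /conv big1 // => A A0.
apply: etrans (congr1 _ (etrans (tensmap_ext (fun=> erefl) _ _) (tensmap0r _ _ _))) (linear0 _).
move=> y; apply: IH; apply: leq_trans In.
have -> : #|subset_type (~: A)| = #|~: A| by rewrite card_sig.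
by rewrite -(cardsC A) -[X in (X < _)%N]add0n ltn_add2r.
Qed.

(** Pascal's rule: in id * psi_n the empty subset contributes psi_n, and the other subsets
    contribute (id - iota o epsilon) * psi_n. *)
Lemma adams_binomial n (I : finType) (x : h I) :
  adams n I x = \sum_(j < n.+1) 'C(n, j)%:R *: pos_power j I x.
Proof.
elim: n I x => [|n IH] I x; first by rewrite big_ord1 bin0 scale1r.
rewrite [LHS]/= /conv (bigD1 set0) //=.
rewrite conv_term_void_l; last by rewrite card_sig cards0.
rewrite (eq_bigl (fun A : {set I} => 0 < #|A|)%N); last by move=> A; rewrite card_gt0.
rewrite (eq_bigr (fun A => \sum_(j < n.+1) 'C(n, j)%:R *:
    conv_term (decomp_set A) idfun (pos_power j _) x)); last first.
  move=> A _; apply: (etrans _ (conv_term_sumr _ _ _ _ _)).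
  apply: (congr1 (fun g => conv_term _ _ g x)); apply/funext => y; exact: IH.
rewrite exchange_big IH /=.
under [X in _ + X]eq_bigr do rewrite -scaler_sumr -/(conv _ _ _).
rewrite big_ord_recl [in RHS]big_ord_recl /= !bin0 -addrA; congr (_ + _).
under [RHS]eq_bigr do rewrite binS natrD scalerDl.
rewrite big_split /=; congr (_ + _).
(* The surplus last term carries C(n, n + 1) = 0. *)
by rewrite [RHS]big_ord_recr /= /bump /= bin_small // scale0r addr0.
Qed.

(** Makes the range of summation independent of n, as comparing coefficients requires: terms beyond
    n vanish by C(n, j) = 0, terms beyond [#|I|] by [pos_power_small], and j = 0 because I is
    nonempty. *)
Lemma adams_binpoly n (I : finType) (x : h I) (k_char0 : [pchar k] =i pred0) :
  (0 < #|I|)%N ->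
  adams n I x = \sum_(j < #|I|) (binpoly k j.+1).[n%:R] *: pos_power j.+1 I x.
Proof.
move=> I0; have P0 : pos_power 0 I x = 0 by rewrite /= /unit_fun -[#|I| == _]negbK -lt0n I0.
pose F j := 'C(n, j)%:R *: pos_power j I x : h I.
transitivity (\sum_(j < #|I|.+1) F j); last first.
  by rewrite big_ord_recl {1}/F P0 scaler0 add0r; apply: eq_bigr => j _; rewrite binpolyE.
rewrite adams_binomial; case: (leqP n #|I|) => nI.
  rewrite (big_ord_widen #|I|.+1 F) // big_mkcond; apply: eq_bigr => j _.
  by case: ifP => // /negbT; rewrite -leqNgt /F => nj; rewrite bin_small // scale0r.
rewrite [RHS](big_ord_widen n.+1 F) 1?ltnW // [RHS]big_mkcond; apply: eq_bigr => j _.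
by case: ifP => // /negbT; rewrite -leqNgt => Ij; rewrite pos_power_small // scaler0.
Qed.

End Powers.

(** * The logarithm on products and coproducts *)

Section Logarithm.
Variables (k : fieldType) (h : bimonoid k).
Hypotheses (k_char0 : [pchar k] =i pred0) (h_conn : connected_bimonoid h).

(** The coefficient of n in psi_n, with no reference to compositions; [log_idE] identifies it with
    [log_id]. *)
Definition log_fun (I : finType) (x : h I) : h I :=
  \sum_(j < #|I|) (binpoly k j.+1)`_1 *: pos_power h j.+1 I x.

Lemma log_fun_linear (I : finType) : linear (@log_fun I).
Proof.
move=> c x y; rewrite /log_fun scaler_sumr -big_split /=.
by apply: eq_bigr => j _; rewrite linearP scalerDr !scalerA mulrC.
Qed.
HB.instance Definition _ (I : finType) :=
  GRing.isLinear.Build k (h I) (h I) *:%R (@log_fun I) (@log_fun_linear I).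

Lemma log_fun_natural (I J : finType) (s : bijection I J) (x : h I) :
  log_fun (sp_map h s x) = sp_map h s (log_fun x).
Proof.
rewrite /log_fun linear_sum -(bij_eq_card (bij_prf s)); apply: eq_bigr => j _.
by rewrite linearZ /= -[conv _ _ _]/(pos_power h j.+1 J _) sp_morph_natural.
Qed.

Lemma tensmap_adams n (S T : finType) (t : tensor (h S) (h T)) :
  (0 < #|S|)%N -> (0 < #|T|)%N ->
  tensmap (adams h n S) (adams h n T) t =
  \sum_(p : 'I_#|S| * 'I_#|T|)
    (binpoly k p.1.+1 * binpoly k p.2.+1).[n%:R] *:
      tensmap (pos_power h p.1.+1 S) (pos_power h p.2.+1 T) t.
Proof.
move=> S0 T0.
apply: etrans (tensmap_ext (fun y => adams_binpoly h_conn n y k_char0 S0)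
                           (fun y => adams_binpoly h_conn n y k_char0 T0) t) _.
apply: etrans (tensmap_suml _ _ _ _ _ _) _.
rewrite -(pair_big predT predT (fun (i : 'I_#|S|) (j : 'I_#|T|) =>
  (binpoly k i.+1 * binpoly k j.+1).[n%:R] *:
      tensmap (pos_power h i.+1 S) (pos_power h j.+1 T) t)) /=.
apply: eq_bigr => i _; rewrite (etrans (congr1 _ (tensmap_sumr _ _ _ _ _ _)) (scaler_sumr _ _ _ _)).
by apply: eq_bigr => j _; rewrite scalerA hornerM.
Qed.

(** Both factors vanish at 0, so X^2 divides the product. *)
Lemma coef1_binpolyM i j : (binpoly k i.+1 * binpoly k j.+1)`_1 = 0.
Proof. by rewrite coefM big_ord_recl big_ord1 /= !coef0_binpoly mul0r mulr0 addr0. Qed.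

Lemma log_fun_mu (I S T : finType) (d : decomp I S T) (t : tensor (h S) (h T)) :
  commutative_bimonoid h -> (0 < #|S|)%N -> (0 < #|T|)%N ->
  log_fun (\mu[h]_d t) = 0.
Proof.
move=> hC S0 T0.
have I0 : (0 < #|I|)%N by rewrite (decomp_card d) addn_gt0 S0.
(* Zero is presented as the coefficient of n in mu o (psi_n ⊗ psi_n), so that [coef1_ext] can
   compare it with that of psi_n o mu. *)
transitivity (\sum_(p : 'I_#|S| * 'I_#|T|) (binpoly k p.1.+1 * binpoly k p.2.+1)`_1 *:
      \mu[h]_d (tensmap (pos_power h p.1.+1 S) (pos_power h p.2.+1 T) t)); last first.
  by rewrite big1 // => p _; rewrite coef1_binpolyM scale0r.
apply: (coef1_ext k_char0 (p := fun j : 'I_#|I| => binpoly k j.+1)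
  (v := fun j : 'I_#|I| => pos_power h j.+1 I (\mu[h]_d t))) => n.
apply: etrans (esym (adams_binpoly h_conn n _ k_char0 I0)) _.
apply: etrans (adams_mu n hC d t) _.
apply: etrans (congr1 _ (tensmap_adams n t S0 T0)) _.
by rewrite linear_sum; apply: eq_bigr => p _; rewrite linearZ.
Qed.

Lemma Delta_log_fun (I S T : finType) (d : decomp I S T) (x : h I) :
  cocommutative_bimonoid h -> (0 < #|S|)%N -> (0 < #|T|)%N ->
  \Delta[h]_d (log_fun x) = 0.
Proof.
move=> hC S0 T0.
have I0 : (0 < #|I|)%N by rewrite (decomp_card d) addn_gt0 S0.
transitivity (\sum_(p : 'I_#|S| * 'I_#|T|) (binpoly k p.1.+1 * binpoly k p.2.+1)`_1 *:
      tensmap (pos_power h p.1.+1 S) (pos_power h p.2.+1 T) (\Delta[h]_d x)); last first.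
  by rewrite big1 // => p _; rewrite coef1_binpolyM scale0r.
rewrite /log_fun linear_sum.
rewrite (eq_bigr (fun j : 'I_#|I| => (binpoly k j.+1)`_1 *:
  \Delta[h]_d (pos_power h j.+1 I x))); last by move=> j _; rewrite linearZ.
apply: (coef1_ext k_char0 (p := fun j : 'I_#|I| => binpoly k j.+1)) => n.
apply: (etrans _ (tensmap_adams n _ S0 T0)).
apply: (etrans _ (adams_Delta n hC d x)).
apply: (etrans _ (congr1 _ (esym (adams_binpoly h_conn n _ k_char0 I0)))).
by rewrite linear_sum; apply: eq_bigr => p _; rewrite linearZ.
Qed.

End Logarithm.

(** * Sums over compositions *)

Section Compositions.
Variables (k : fieldType) (h : bimonoid k) (h_conn : connected_bimonoid h).
Variable I : finType.
Implicit Types (A B S T U : {set I}) (F : seq {set I}).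

Lemma decomp_sub_subproof B S : bijective
  (case_sum (subset_incl (subsetIl B S)) (subset_incl (subsetDl B S))).
Proof.
apply: decomp_intro.
- by move=> x y e; apply: val_inj; exact: (congr1 val e).
- by move=> x y e; apply: val_inj; exact: (congr1 val e).
- move=> [x xI] [y yD] /(congr1 val) /= xy; subst y.
  by move: xI yD; rewrite !inE => /andP[_ ->].
move=> [x xB]; have [xS|xS] := boolP (x \in S); [left|right].
  have xI : x \in B :&: S by rewrite inE xB.
  by exists (Sub x xI); apply: val_inj.
have xD : x \in B :\: S by rewrite inE xB xS.
by exists (Sub x xD); apply: val_inj.
Qed.
(** Keeps both parts as subsets of I, where [decomp_set] on [subset_type B] would nest subtypes;
    compositions are sequences of subsets of I. *)
Definition decomp_sub B S : decomp (subset_type B) (subset_type (B :&: S))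
    (subset_type (B :\: S)) :=
  Decomp (decomp_sub_subproof B S).

(* The operator mu_F Delta_F on h[B], extended by 0 to the sequences F that are
   not compositions of B; see block_op_blocks and block_op_notin. *)
Fixpoint block_op F : forall B, {linear h (subset_type B) -> h (subset_type B)} :=
  if F is A :: F' then fun B =>
    if (A != set0) && (A \subset B)
    then (conv_term (decomp_sub B A) idfun (block_op F' (B :\: A)) : {linear _ -> _})
    else (\0 : {linear _ -> _})
  else fun B => (@unit_fun k h (subset_type B) : {linear _ -> _}).

Lemma decomp_image_sub B S :
  decomp_image (decomp_sub B S) = [set x | val x \in S].
Proof.
apply/setP => -[x xB]; rewrite inE /=; apply/imsetP/idP => [[[y yI] _ /(congr1 val)/= ->]|xS].
  by move: yI; rewrite inE => /andP[].
have xI : x \in B :&: S by rewrite inE xB.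
by exists (Sub x xI) => //; apply: val_inj.
Qed.

(** One convolution step chooses the first block inside B. Because [block_op] is 0 off compositions,
    the sum can run over all tuples and factors into a sum over heads and a sum over tails. *)
Lemma pos_power_blocks n B (x : h (subset_type B)) :
  pos_power h n (subset_type B) x = \sum_(F : n.-tuple {set I}) block_op F B x.
Proof.
elim: n B x => [|n IH] B x.
  by rewrite (big_pred1 [tuple]) // => F; apply/esym/eqP; exact: tuple0.
pose J := {S : {set I} | S \subset B}.
apply: etrans (conv_reindex _ _ (d := fun j : J => decomp_sub B (val j)) x _) _.
  apply: inj_surj_bij => [[S SB] [T TB] /=|A].
    rewrite !decomp_image_sub => /setP e; apply: val_inj => /=; apply/setP => y.
    have [yB|yB] := boolP (y \in B); first by have := e (Sub y yB); rewrite !inE.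
    by rewrite !(contraNF (subsetP _ y) yB).
  have AB : [set val y | y in A] \subset B.
    by apply/subsetP => _ /imsetP[y _ ->]; exact: (valP y).
  exists (exist (fun S : {set I} => is_true (S \subset B)) _ AB).
  rewrite decomp_image_sub; apply/setP => y.
  by rewrite inE /= mem_imset //; exact: val_inj.
rewrite (eq_bigl (fun j : J => val j != set0)); last first.
  by move=> [S SB] /=; rewrite card_sig (eq_card (B := mem (B :&: S))) // (setIidPr SB) card_gt0.
rewrite -(big_sub_cond (fun S => S \subset B) (fun S => S != set0)
  (fun S => conv_term (decomp_sub B S) idfun (pos_power h n _) x)).
rewrite (reindex (fun p : {set I} * n.-tuple {set I} => [tuple of p.1 :: p.2])); last first.
  exists (fun F : n.+1.-tuple {set I} => (thead F, [tuple of behead F])) => [[S F] _|F _].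
    by congr pair; apply: val_inj.
  by rewrite /= -tuple_eta.
rewrite -(pair_big predT predT (fun S (F : n.-tuple {set I}) => block_op (S :: F) B x)) /=.
rewrite big_mkcond; apply: eq_bigr => S _; rewrite andbC.
case: ifP => _; last by rewrite big1.
pose g F := block_op F (B :\: S).
transitivity (\sum_(F : n.-tuple {set I}) 1 *: conv_term (decomp_sub B S) idfun (g F) x).
  apply: (etrans _ (conv_term_sumr _ _ _ _ _)).
  apply: (congr1 (fun g => conv_term _ _ g x)); apply/funext => y; rewrite IH.
  by apply: eq_bigr => F _; rewrite scale1r.
by apply: eq_bigr => F _; rewrite scale1r.
Qed.

Lemma block_op_notin F B (x : h (subset_type B)) :
  ~~ [&& all (fun S => S != set0) F, pairwise (@disjoint_sets I) F
       & \bigcup_(S <- F) S == B] -> block_op F B x = 0.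
Proof.
elim: F B x => [|S F IH] B x.
  rewrite big_nil /= eq_sym -card_gt0 => B0.
  by rewrite /unit_fun card_sig (eq_card (B := mem B)) // eqn0Ngt B0.
move=> nF /=; case: ifP => //= /andP[S0 SB].
apply: etrans (congr1 _ (etrans (tensmap_ext (fun=> erefl) _ _) (tensmap0r _ _ _))) (linear0 _).
(* If F is a composition of B minus S, with S nonempty inside B, then S :: F is one of B; so the
   failure passes to the tail. *)
move=> y; apply: IH; apply: contra nF => /and3P[F0 Fd /eqP FB].
rewrite /= S0 F0 Fd big_cons FB !andbT /=; apply/andP; split; last first.
  by apply/eqP/setP => z; rewrite !inE; case: (boolP (z \in S)) => // /(subsetP SB)->.
apply/allP => T TF; rewrite /disjoint_sets disjoints_subset; apply/subsetP => z zS.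
rewrite inE; apply/negP => zT.
suff : z \in B :\: S by rewrite inE zS.
by rewrite -FB; move: TF => /splitPr[F1 F2]; rewrite big_cat big_cons /= !inE zT orbT.
Qed.

(** Equal subsets have types that need not be convertible; a bijection preserving underlying
    elements replaces the transport. *)
Lemma subset_type_bij A A' : A = A' ->
  exists a : bijection (subset_type A) (subset_type A'), (forall x, val (a x) = val x) /\
    forall F y, block_op F A' (sp_map h a y) = sp_map h a (block_op F A y).
Proof.
move=> <-; exists (bij_id _); split=> // F y.
have id1 : sp_map h (bij_id (subset_type A)) =1 id by exact: sp_map_id.
by rewrite !id1.
Qed.

Lemma block_op_cons S F B U (d : decomp (subset_type B) (subset_type S) (subset_type U)) x :
  S != set0 -> S \subset B ->
  (forall s, val (dl d s) = val s) -> (forall u, val (dr d u) = val u) ->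
  block_op (S :: F) B x = conv_term d idfun (block_op F U) x.
Proof.
move=> S0 SB dlE drE; rewrite /= S0 SB /=.
have [a [aE _]] := subset_type_bij (setIidPr SB).
have UE : B :\: S = U.
  apply/setP => z; rewrite inE; apply/andP/idP => [[zS zB]|zU].
    case: (decomp_cover d (Sub z zB)) => -[u /(congr1 val) /=].
      by rewrite [sval _]dlE => us; move: zS; rewrite -us (valP u).
    by rewrite [sval _]drE => <-; exact: (valP u).
  have zE := drE (Sub z zU); split; last by rewrite -[z]zE; exact: (valP (dr d _)).
  apply/negP => zS; apply: (@dl_dr _ _ _ d (Sub z zS) (Sub z zU)); apply: val_inj.
  by rewrite dlE drE.
have [b [bE bop]] := subset_type_bij UE.
have id1 : sp_map h (bij_id (subset_type B)) =1 id by exact: sp_map_id.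
have dab : decomp_map (decomp_sub B S) d (bij_id _) a b.
  by split=> z; apply: val_inj; rewrite /= [RHS](dlE, drE) ?aE ?bE.
rewrite -[LHS]id1.
apply: etrans (@conv_term_map _ _ _ _ _ _ _ _ _ _ _ a b
  idfun (block_op F (B :\: S)) idfun (block_op F U) x dab
  (fun=> erefl) (fun y => esym (bop F y))) _.
by apply: (congr1 (conv_term d idfun (block_op F U))); exact: id1.
Qed.

Lemma mu_blocks_linear F S (dF : disjoint_blocks S F) : linear (mu_blocks (h := h) dF).
Proof.
elim: F S dF => [//|T F IH] S dF.
pose G : {linear _ -> _} :=
  HB.pack (mu_blocks (h := h) (disjoint_blocks_tail dF))
    (GRing.isLinear.Build _ _ _ _ _ (IH T (disjoint_blocks_tail dF))).
move=> c u v; apply: (etrans _ (linearP (\mu[h]_(subset_decomp _)) _ _ _)).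
by apply: (congr1 (\mu[h]_(subset_decomp _))); exact: (tensmap_linear idfun G).
Qed.
HB.instance Definition _ F S (dF : disjoint_blocks S F) :=
  GRing.isLinear.Build _ _ _ _ (mu_blocks (h := h) dF) (mu_blocks_linear dF).

Lemma block_op_blocks F S (dF : disjoint_blocks S F) x :
  all (fun S => S != set0) (S :: F) ->
  block_op (S :: F) (blocks_union S F) x = mu_blocks dF (Delta_blocks (h := h) dF x).
Proof.
elim: F S dF x => [|T F IH] S dF x /andP[S0 F0].
  rewrite /= S0 subxx /=.
  (* For a single block the remainder is empty, and connectedness turns the convolution term into
     the identity. *)
  have D0 : #|subset_type (S :\: S)| = 0%N.
    by rewrite setDv card_sig; apply: eq_card0 => z; rewrite !inE.
  apply: etrans (conv_term_void_r h_conn (decomp_sub S S) x D0).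
  by apply: (congr1 (fun g => conv_term _ _ g x)); apply/funext => y /=; rewrite /unit_fun D0.
apply: etrans (@block_op_cons S (T :: F) _ _ (subset_decomp (disjoint_blocks_head dF)) x S0
  (subsetUl _ _) (fun=> erefl) (fun=> erefl)) _.
apply: (congr1 (\mu[h]_(subset_decomp (disjoint_blocks_head dF)))).
apply: (etrans _ (esym (tensmap_comp idfun (Delta_blocks (h := h) (disjoint_blocks_tail dF))
  idfun (mu_blocks (h := h) (disjoint_blocks_tail dF)) _))).
by apply: tensmap_ext => // y; exact: IH.
Qed.

Lemma sum_mu_Delta_comp n (x : h I) :
  \sum_(F : composition I n) mu_comp (Delta_comp F x) = pos_power h n.+1 I x.
Proof.
pose G (F : n.+1.-tuple {set I}) : h I := sp_map h (full_val_bij (erefl [set: I]))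
  (block_op F [set: I] (sp_map h (full_sub_bij (erefl [set: I])) x)).
transitivity (\sum_(F : composition I n) G (val F)).
  apply: eq_bigr => F _; rewrite /G /mu_comp /Delta_comp -block_op_blocks; last first.
    by rewrite blocksE; have /and3P[] := valP F.
  (* Abstracting the union of the blocks lets its equality with the full set be replaced by
     reflexivity, as in [G]. *)
  rewrite blocksE; move: (composition_full F); move: (blocks_union _ _) => A fA.
  by subst A.
rewrite -(big_sub (fun F : n.+1.-tuple {set I} => is_composition F)) big_mkcond.
transitivity (\sum_(F : n.+1.-tuple {set I}) G F).
  apply: eq_bigr => F _; case: ifP => // /negbT nF.
  by rewrite /G block_op_notin ?linear0.
rewrite -linear_sum -pos_power_blocks -sp_morph_natural.
apply: congr1; apply: etrans (esym (sp_map_comp (u := bij_id I) _ _)) _ => //.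
exact: sp_map_id.
Qed.

End Compositions.

Lemma log_idE (k : fieldType) (h : bimonoid k) (h_conn : connected_bimonoid h)
    (k_char0 : [pchar k] =i pred0) (I : finType) (x : h I) :
  log_id x = log_fun x.
Proof.
apply: eq_bigr => n _; rewrite -scaler_sumr sum_mu_Delta_comp //.
by rewrite coef1_binpoly.
Qed.

(** * Primitive elements and indecomposables *)

Section Corollary.
Variables (k : fieldType) (h : bimonoid k).
Hypotheses (k_char0 : [pchar k] =i pred0) (h_conn : connected_bimonoid h).

Lemma log_fun_empty (I : finType) (x : h I) : #|I| = 0%N -> log_fun x = 0.
Proof. by move=> I0; rewrite /log_fun I0 big_ord0. Qed.

Lemma pos_power_empty n (I : finType) (x : h I) : #|I| = 0%N -> pos_power h n.+1 I x = 0.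
Proof.
move=> I0; apply: big_pred0 => A; apply: negbTE; rewrite -eqn0Ngt -leqn0 -I0.
exact: max_card.
Qed.

Lemma card_subset_type (I : finType) (A : {set I}) : #|subset_type A| = #|A|.
Proof. by rewrite card_sig. Qed.

Lemma pos_power_one (I : finType) (x : h I) : (0 < #|I|)%N -> pos_power h 1 I x = x.
Proof.
move=> I0; rewrite [LHS]/= /conv (bigD1 [set: I]) ?cardsT //=.
rewrite big1 ?addr0 => [|A /andP[_ AT]]; last first.
  apply: etrans (congr1 _ (etrans (tensmap_ext (fun=> erefl) _ _) (tensmap0r _ _ _))) (linear0 _).
  move=> y; rewrite /= /unit_fun card_subset_type cards_eq0.
  by rewrite -subset0 -setCT setCS subTset (negPf AT).
have T0 : #|subset_type (~: [set: I])| = 0%N by rewrite card_subset_type setCT cards0.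
apply: (etrans _ (conv_term_void_r h_conn (decomp_set [set: I]) x T0)).
by apply: (congr1 (fun g => conv_term _ _ g x)); apply/funext => y; rewrite /= /unit_fun T0.
Qed.

(** The term A = I drops out because [pos_power h n.+1] is 0 on the empty complement. Each remaining
    term passes through a coproduct and a product with both parts nonempty, hence kills primitives
    and is decomposable. *)
Lemma pos_power_proper n (I : finType) (x : h I) :
  pos_power h n.+2 I x =
  \sum_(A : {set I} | (0 < #|A|)%N && (0 < #|~: A|)%N)
    conv_term (decomp_set A) idfun (pos_power h n.+1 _) x.
Proof.
rewrite [LHS]/= /conv (bigID (fun A : {set I} => (0 < #|~: A|)%N)) /=.
rewrite [X in _ + X]big1 ?addr0 // => A /andP[_]; rewrite -eqn0Ngt => /eqP A0.
apply: etrans (congr1 _ (etrans (tensmap_ext (fun=> erefl) _ _) (tensmap0r _ _ _))) (linear0 _).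
by move=> y; apply: pos_power_empty; rewrite card_subset_type.
Qed.

Lemma log_fun_split (I : finType) (x : h I) : (0 < #|I|)%N ->
  log_fun x = x + \sum_(j < #|I|.-1) (binpoly k j.+2)`_1 *: pos_power h j.+2 I x.
Proof.
move=> I0; have P1 := pos_power_one x I0; rewrite /log_fun.
case: #|I| I0 => // m _; rewrite big_ord_recl P1.
by rewrite coef1_binpoly // divr1 expr0 scale1r.
Qed.

Lemma log_fun_primitive (I : finType) (y : h I) : primitive y -> log_fun y = y.
Proof.
case=> y0 yP; have [/eqP I0|I0] := posnP #|I|.
  by rewrite log_fun_empty ?y0 //; exact/eqP.
rewrite log_fun_split // big1 ?addr0 // => j _.
rewrite pos_power_proper big1 ?scaler0 // => A /andP[A0 A1].
by rewrite /conv_term yP ?card_subset_type // !linear0.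
Qed.

Lemma log_fun_mod_decomposable (I : finType) (x : h I) :
  Defs.span (@decomposable k h I) (log_fun x - x).
Proof.
(* On an empty set every element counts as decomposable, since the indecomposable quotient vanishes
   there. *)
have [I0|I0] := posnP #|I|; first by apply: span_gen; left.
rewrite log_fun_split // addrC addKr.
apply: (big_ind (Defs.span (@decomposable k h I))) => [|u v|j _]; first exact: span0.
  exact: spanD.
apply: spanZ; rewrite pos_power_proper.
apply: (big_ind (Defs.span (@decomposable k h I))) => [|u v|A /andP[A0 A1]]; first exact: span0.
  exact: spanD.
by apply: span_gen; right; do 4!eexists; split; last reflexivity; rewrite card_subset_type.
Qed.

Section Cocommutative.
Hypothesis h_cocomm : cocommutative_bimonoid h.

Lemma primitive_log_fun (I : finType) (x : h I) : primitive (log_fun x).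
Proof.
by split=> [/log_fun_empty//|S T d S0 T0]; exact: Delta_log_fun.
Qed.

Definition log_prim (I : finType) (x : h I) : prim_obj h I :=
  exist _ (log_fun x) (asboolT (primitive_log_fun x)).

Lemma log_prim_linear (I : finType) : linear (@log_prim I).
Proof. by move=> c x y; apply: val_inj; rewrite /= !linearP. Qed.
HB.instance Definition _ (I : finType) :=
  GRing.isLinear.Build k (h I) (prim_obj h I) *:%R (@log_prim I) (@log_prim_linear I).

Lemma log_prim_natural (I J : finType) (s : bijection I J) (x : h I) :
  log_prim (sp_map h s x) = sp_map (prim_species h) s (log_prim x) :> prim_species h J.
Proof. by apply: val_inj; exact: log_fun_natural. Qed.

Definition log_prim_morph : sp_morph h (prim_species h) :=
  @SpMorph k h (prim_species h) (fun I => (@log_prim I : {linear h I -> prim_obj h I}))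
    log_prim_natural.

End Cocommutative.

Section Commutative.
Hypothesis h_comm : commutative_bimonoid h.

Lemma log_fun_decomposable (I : finType) (x : h I) :
  Defs.span (@decomposable k h I) x -> log_fun x = 0.
Proof.
elim=> [|c u v uD _ IH]; first exact: linear0.
rewrite linearP /= IH addr0.
case: uD => [I0|[S [T [d [t [S0 T0 ->]]]]]]; first by rewrite log_fun_empty ?scaler0.
by rewrite log_fun_mu ?scaler0.
Qed.

Definition log_indec (I : finType) (q : indec_obj h I) : h I := log_fun (qrepr q).

Lemma log_indec_qproj (I : finType) (x : h I) :
  log_indec (qproj x : indec_obj h I) = log_fun x.
Proof.
apply/eqP; rewrite -subr_eq0 -linearB; apply/eqP/log_fun_decomposable.
by apply: (proj1 (qprojP _ _ _)); rewrite qreprK.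
Qed.

Lemma log_indec_linear (I : finType) : linear (@log_indec I).
Proof.
move=> c p q; rewrite -[p]qreprK -[q]qreprK -qproj_is_linear !log_indec_qproj.
exact: linearP.
Qed.
HB.instance Definition _ (I : finType) :=
  GRing.isLinear.Build k (indec_obj h I) (h I) *:%R (@log_indec I) (@log_indec_linear I).

Lemma log_indec_natural (I J : finType) (s : bijection I J) (q : indec_species h I) :
  log_indec (sp_map (indec_species h) s q : indec_obj h J) = sp_map h s (log_indec q).
Proof.
by rewrite -[q](qreprK q) -qproj_natural !log_indec_qproj log_fun_natural.
Qed.

Definition log_indec_morph : sp_morph (indec_species h) h :=
  @SpMorph k (indec_species h) h
    (fun I => (@log_indec I : {linear indec_obj h I -> h I})) log_indec_natural.

End Commutative.

End Corollary.

Theorem corollary80 (k : fieldType) (k_char0 : [pchar k] =i pred0)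
    (h : bimonoid k) (h_conn : connected_bimonoid h) :
  (cocommutative_bimonoid h ->
     exists p : sp_morph h (prim_species h),
       (forall (I : finType) (x : h I), prim_incl h I (p I x) = log_id x) /\
       (forall (I : finType) (y : prim_species h I), p I (prim_incl h I y) = y)) /\
  (commutative_bimonoid h ->
     exists s : sp_morph (indec_species h) h,
       (forall (I : finType) (x : h I), s I (indec_proj h I x) = log_id x) /\
       (forall (I : finType) (y : indec_species h I), indec_proj h I (s I y) = y)).
Proof.
split=> hC.
  exists (log_prim_morph k_char0 h_conn hC); split=> [I x|I y].
    exact: esym (log_idE h_conn k_char0 x).
  apply: val_inj; exact: log_fun_primitive (asboolW (valP y)).
exists (log_indec_morph k_char0 h_conn hC); split=> [I x|I y].
  exact: etrans (log_indec_qproj _ _ _ x) (esym (log_idE h_conn k_char0 x)).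
rewrite -[y](qreprK y); apply: etrans (congr1 _ (log_indec_qproj _ _ _ _)) _ => //.
(* The section applied to a class is log(id) of a representative, which differs from that
   representative by decomposables. *)
by apply: (proj2 (qprojP _ _ _)); exact: log_fun_mod_decomposable.
Qed.
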